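(* Let $V$ be a countably infinite set, $\mu\colon V\to(0,\infty)$, and $b\colon V\times V\to[0,\infty)$ with $b(x,y)=b(y,x)$, $b(x,x)=0$, and $\deg(x):=\#\{y\in V: b(x,y)>0\}<\infty$ for all $x,y\in V$. Assume the weighted graph $(V,b,\mu)$ is connected and that $\mu(x)\geq\mu_0$ for all $x\in V$, for some constant $\mu_0>0$. Let $\theta\colon V\times V\to[-\pi,\pi]$ satisfy $\theta(x,y)=-\theta(y,x)$. Let $q\colon[0,\infty)\to(0,\infty)$ be a non-decreasing function with $q(s)=O(s^{\alpha})$ for some $0\leq\alpha\leq 1$. Let $W\colon V\to\mathbb{R}$ satisfy $W(x)\geq -q(r(x))$ for all $x\in V$, where $r(x)=d(x_0,x)$ for a fixed vertex $x_0\in V$. In the case $0<\alpha\leq 1$, assume that the sequence $\{n^{\alpha-1}d_np_n\}_{n\in\mathbb{Z}_+}$ is bounded. In the case $\alpha=0$, assume that there exist numbers $0<K<\frac{\mu_0}{2}$ and $N\in\mathbb{Z}_+$ such that $\frac{d_np_n}{n}\leq K$ for all $n\geq N$. Then the operator $Hu=\Delta_{b,\theta}^2u+Wu$ is essentially self-adjoint on $C_c(V)$ in the Hilbert space $\ell^2(V,\mu)$.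
   Context: Vertices $x,y$ are neighbors ($x\sim y$) if $b(x,y)>0$; connectedness means any two vertices are joined by a finite path $x=x_0\sim x_1\sim\dots\sim x_n=y$, and $d(x,y)$ is the combinatorial distance (minimal number of edges in such a path). $C(V)$ denotes complex-valued functions on $V$, $C_c(V)$ the finitely supported ones, and $\ell^2(V,\mu)$ the space of $f\in C(V)$ with $\|f\|^2=\sum_{x}\mu(x)|f(x)|^2<\infty$, with inner product $(f,g)=\sum_x\mu(x)f(x)\overline{g(x)}$. The magnetic Laplacian is $(\Delta_{b,\theta}u)(x)=\frac{1}{\mu(x)}\sum_{y\in V}b(x,y)(u(x)-e^{i\theta(x,y)}u(y))$, and $\Delta_{b,\theta}^2u=\Delta_{b,\theta}(\Delta_{b,\theta}u)$. For $n\in\mathbb{Z}_+=\{1,2,\dots\}$, $B(x_0,n)$ consists of the vertices $x$ with $r(x)\leq n$ (together with edges between such vertices), $d_n:=\max_{x\in B(x_0,n)}\deg(x)$, and $p_n:=\max_{x\in B(x_0,n)}\max_{y\in V}b(x,y)$. *)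

(* Defs.v *)
From HB Require Import structures.
From mathcomp Require Import all_boot all_order all_algebra.
From mathcomp Require Import all_classical all_reals.
From mathcomp Require Import topology normedtype sequences esum exp trigo.
From mathcomp Require Import finmap complex.

Set Implicit Arguments.
Unset Strict Implicit.
Unset Printing Implicit Defensive.

Import Order.TTheory GRing.Theory Num.Theory.
Local Open Scope classical_set_scope.
Local Open Scope ring_scope.

Section Defs.
Variable R : realType.
Variable V : countType.

Definition walk (b : V -> V -> R) (x y : V) (n : nat) : Prop :=
  exists p : nat -> V, [/\ p 0%N = x, p n = y &
     forall i, (i < n)%N -> 0 < b (p i) (p i.+1)].

Definition graph_connected (b : V -> V -> R) : Prop :=
  forall x y : V, exists n, walk b x y n.

Definition gdist (b : V -> V -> R) (x y : V) : nat :=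
  xget 0%N [set n | walk b x y n /\ forall m, walk b x y m -> (n <= m)%N].

Definition deg (b : V -> V -> R) (x : V) : nat :=
  (#|` fset_set [set y | 0 < b x y] |)%fset.

Definition ball_vert (b : V -> V -> R) (x0 : V) (n : nat) : set V :=
  [set x | (gdist b x0 x <= n)%N].

(* d_n = max_{x in B(x0,n)} deg(x)   (the ball is finite and nonempty) *)
Definition d_seq (b : V -> V -> R) (x0 : V) (n : nat) : R :=
  sup [set (deg b x)%:R | x in ball_vert b x0 n].

Definition p_seq (b : V -> V -> R) (x0 : V) (n : nat) : R :=
  sup [set b xy.1 xy.2 | xy in [set xy : V * V | ball_vert b x0 n xy.1]].

Local Open Scope complex_scope.

Definition expi (t : R) : R[i] := (cos t +i* sin t).

(* magnetic Laplacian; the sum over y has finitely many nonzero terms *)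
Definition mag_lap (mu : V -> R) (b : V -> V -> R) (theta : V -> V -> R)
    (u : V -> R[i]) (x : V) : R[i] :=
  ((mu x)^-1)%:C *
  (\sum_(y \in [set: V]) ((b x y)%:C * (u x - expi (theta x y) * u y)))%R.

Definition Hop (mu : V -> R) (b : V -> V -> R) (theta : V -> V -> R)
    (W : V -> R) (u : V -> R[i]) (x : V) : R[i] :=
  mag_lap mu b theta (mag_lap mu b theta u) x + (W x)%:C * u x.

Definition finsupp (u : V -> R[i]) : Prop := finite_set [set x | u x != 0].

Definition sqnorm (z : R[i]) : R := complex.Re z ^+ 2 + complex.Im z ^+ 2.

Definition l2norm2 (mu : V -> R) (f : V -> R[i]) : \bar R :=
  \esum_(x in [set: V]) ((mu x * sqnorm (f x))%:E).

Definition in_l2 (mu : V -> R) (f : V -> R[i]) : Prop :=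
  (l2norm2 mu f < +oo)%E.

(* sum of an absolutely summable real family over V *)
Definition rsum (F : V -> R) : R :=
  fine (\esum_(x in [set: V]) (Num.max (F x) 0)%:E)
  - fine (\esum_(x in [set: V]) (Num.max (- F x) 0)%:E).

Definition l2ip (mu : V -> R) (f g : V -> R[i]) : R[i] :=
  (rsum (fun x => mu x * complex.Re (f x * conjc (g x))))
  +i* (rsum (fun x => mu x * complex.Im (f x * conjc (g x)))).

Definition opgraph := (V -> R[i]) -> (V -> R[i]) -> Prop.

Definition adjoint (mu : V -> R) (G : opgraph) : opgraph :=
  fun v w => [/\ in_l2 mu v, in_l2 mu w &
    forall u Tu, G u Tu -> l2ip mu Tu v = l2ip mu u w].

Definition closure_op (mu : V -> R) (G : opgraph) : opgraph :=
  fun v w => [/\ in_l2 mu v, in_l2 mu w &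
    exists (un wn : nat -> V -> R[i]),
      (forall n, G (un n) (wn n)) /\
      forall e : R, 0 < e -> exists N : nat, forall n, (N <= n)%N ->
        (l2norm2 mu (fun x => (un n x - v x)%R) < e%:E)%E /\
        (l2norm2 mu (fun x => (wn n x - w x)%R) < e%:E)%E].

Definition self_adjoint (mu : V -> R) (G : opgraph) : Prop :=
  forall v w, G v w <-> adjoint mu G v w.

Definition ess_self_adjoint (mu : V -> R) (G : opgraph) : Prop :=
  self_adjoint mu (closure_op mu G).

Definition H_on_Cc (mu : V -> R) (b theta : V -> V -> R) (W : V -> R) : opgraph :=
  fun u v => finsupp u /\ v = Hop mu b theta W u.

End Defs.

(* Main.v *)
(* The deficiency equations of the closure of H reduce to H a = b, H b = - a with
   a, b in l^2.  Let chi be the cut-off min(1, 2 - r/n)^+ and psi = chi^2.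
   Testing the equations against psi b and psi a cancels W and leaves
     |chi a|^2 + |chi b|^2 = ([Delta,psi] b, Delta a) - ([Delta,psi] a, Delta b).
   Since psi(y) - psi(x) = 2 chi(x) (chi(y) - chi(x)) + (chi(y) - chi(x))^2, Schur's
   test bounds the right-hand side by |chi Delta a|, |chi Delta b| and the l^2-mass
   of a, b outside a ball, with the coefficient (row sums of Delta)/n = O(n^-alpha).
   Testing H a = b against psi a gives |chi Delta a|^2 = O(n^alpha), because
   W >= - O(n^alpha) on the ball of radius 2n; hence a = b = 0.
   Only t = n^alpha >= 1 enters: row sums at most c n / t and W >= - c t.

   Essential self-adjointness follows by projection: a sequence in C_c that minimises
   the graph distance to (v, Hv) is Cauchy, and the limit a of the differences
   is orthogonal to the graph of H on C_c, i.e. H H a = - a, so a = 0.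

   Complex functions on V are treated as real functions on V * bool. *)

Require Import Defs.
From HB Require Import structures.
From mathcomp Require Import all_boot all_order all_algebra.
From mathcomp Require Import ring lra zify.
From mathcomp Require Import all_classical all_reals.
From mathcomp Require Import topology ereal normedtype sequences esum exp trigo.
From mathcomp Require Import finmap complex.
Import Order.TTheory GRing.Theory Num.Theory.
Import numFieldNormedType.Exports.
Local Open Scope classical_set_scope.
Local Open Scope ring_scope.
Set Implicit Arguments.
Unset Strict Implicit.
Unset Printing Implicit Defensive.

(** * Commutator estimates with a radial cut-off *)

(** Schur's test with a free parameter: Young's inequality weighted by [lam] splits each term, and
    the symmetry of the weighted absolute values turns column sums into row sums, so the one bound
    [kap] serves both halves. *)
Lemma schur_bound (R : realType) (X : eqType) (s : seq X) (m : X -> R)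
    (K : X -> X -> R) (kap lam : R) (f g : X -> R) :
  (forall x, 0 <= m x) ->
  (forall x y, m x * `|K x y| = m y * `|K y x|) ->
  (forall x, \sum_(y <- s) `|K x y| <= kap) -> 0 < lam ->
  `|\sum_(x <- s) \sum_(y <- s) m x * K x y * f y * g x| <=
    kap / 2 * (lam * (\sum_(x <- s) m x * f x ^+ 2) +
               (\sum_(x <- s) m x * g x ^+ 2) / lam).
Proof.
move=> m0 Ksym Krow lam0.
have step : `|\sum_(x <- s) \sum_(y <- s) m x * K x y * f y * g x| <=
    \sum_(x <- s) \sum_(y <- s) (lam / 2 * (m y * f y ^+ 2 * `|K y x|) +
                                 (2 * lam)^-1 * (m x * g x ^+ 2 * `|K x y|)).
  apply: le_trans (ler_norm_sum _ _ _) _; apply: ler_sum => x _.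
  apply: le_trans (ler_norm_sum _ _ _) _; apply: ler_sum => y _.
  rewrite !normrM (ger0_norm (m0 x)).
  have -> : lam / 2 * (m y * f y ^+ 2 * `|K y x|) +
      (2 * lam)^-1 * (m x * g x ^+ 2 * `|K x y|) =
      m x * `|K x y| * (lam / 2 * f y ^+ 2 + (2 * lam)^-1 * g x ^+ 2).
    by rewrite (mulrAC (m y)) -(Ksym x y); ring.
  rewrite -mulrA ler_wpM2l ?mulr_ge0 //.
  rewrite -(real_normK (num_real (f y))) -(real_normK (num_real (g x))).
  rewrite -subr_ge0.
  have -> : lam / 2 * `|f y| ^+ 2 + (2 * lam)^-1 * `|g x| ^+ 2 - `|f y| * `|g x|
    = (2 * lam)^-1 * (lam * `|f y| - `|g x|) ^+ 2 by field; rewrite gt_eqF.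
  by rewrite mulr_ge0 ?sqr_ge0 // invr_ge0; lra.
apply: le_trans step _.
have row (h : X -> R) : \sum_(x <- s) \sum_(y <- s) m x * h x ^+ 2 * `|K x y| <=
    kap * \sum_(x <- s) m x * h x ^+ 2.
  rewrite mulr_sumr; apply: ler_sum => x _.
  rewrite -mulr_sumr mulrC; apply: ler_wpM2r; last exact: Krow.
  by rewrite mulr_ge0 ?sqr_ge0.
have -> : \sum_(x <- s) \sum_(y <- s) (lam / 2 * (m y * f y ^+ 2 * `|K y x|) +
      (2 * lam)^-1 * (m x * g x ^+ 2 * `|K x y|)) =
    lam / 2 * (\sum_(x <- s) \sum_(y <- s) m x * f x ^+ 2 * `|K x y|) +
    (2 * lam)^-1 * (\sum_(x <- s) \sum_(y <- s) m x * g x ^+ 2 * `|K x y|).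
  rewrite [X in _ = lam / 2 * X + _]exchange_big /= !mulr_sumr -big_split /=.
  by apply: eq_bigr => x _; rewrite !mulr_sumr -big_split.
have h1 := ler_wpM2l (ltW (divr_gt0 lam0 (ltr0n R 2))) (row f).
have l2 : 0 <= (2 * lam)^-1 by rewrite invr_ge0; lra.
have h2 := ler_wpM2l l2 (row g).
apply: le_trans (lerD h1 h2) _.
by rewrite le_eqVlt; apply/orP; left; apply/eqP; field; rewrite gt_eqF.
Qed.

Section Commutator.
Variables (R : realType) (X : eqType) (s : seq X) (m : X -> R).
Variables (K : X -> X -> R) (r : X -> nat) (n : nat) (chi : X -> R) (beta : R).
Hypotheses (m0 : forall x, 0 <= m x).
Hypotheses (Ksym : forall x y, m x * K x y = m y * K y x).
Hypotheses (Kr : forall x y, K x y != 0 -> (r y <= (r x).+1)%N /\ (r x <= (r y).+1)%N).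
Hypotheses (n0 : (0 < n)%N) (beta0 : 0 < beta).
Hypotheses (chi0 : forall x, (n.*2 <= r x)%N -> chi x = 0).
Hypotheses (chi1 : forall x, (r x <= n)%N -> chi x = 1).
Hypotheses (chiL : forall x y, (r y <= (r x).+1)%N -> (r x <= (r y).+1)%N ->
  `|chi y - chi x| <= n%:R^-1).
Hypotheses (Krow : forall x, (r x <= n.*2.+2)%N ->
  \sum_(y <- s) `|K x y| <= beta).

Let B (f : X -> R) x := \sum_(y <- s) K x y * f y.
(** The tail starts at radius [n - 1]: neighbours of the annulus [n <= r <= 2n], where the cut-off
    varies, may lie one layer further in. *)
Let tail (f : X -> R) := \sum_(x <- s | (n <= (r x).+1)%N) m x * f x ^+ 2.
Let energy (g : X -> R) := \sum_(x <- s) m x * (chi x * B g x) ^+ 2.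
(** The pairing of [[B, chi^2] f] with [B g] in the weight [m]. *)
Let comm (f g : X -> R) := \sum_(x <- s) \sum_(y <- s)
  m x * K x y * (chi y ^+ 2 - chi x ^+ 2) * f y * B g x.

Let T x := (n <= (r x).+1)%N.
Let U x := (n <= r x <= n.*2)%N.
Let Z x := (r x <= n.*2.+1)%N.

Let KsymN x y : m x * `|K x y| = m y * `|K y x|.
Proof. by rewrite -{1}(ger0_norm (m0 x)) -{1}(ger0_norm (m0 y)) -!normrM Ksym. Qed.

Lemma K_sym_form (f g : X -> R) :
  \sum_(x <- s) m x * f x * B g x = \sum_(x <- s) m x * B f x * g x.
Proof.
under eq_bigr do rewrite mulr_sumr; rewrite exchange_big /=.
apply: eq_bigr => x _; rewrite mulr_sumr mulr_suml; apply: eq_bigr => y _.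
by rewrite mulrA [m x * _]mulrA -Ksym; ring.
Qed.

(** Symmetry moves one [B] onto [chi^2 f]; commuting it past [chi^2] leaves the localized form and
    the commutator. *)
Lemma form_commutator (f g : X -> R) :
  \sum_(x <- s) m x * (chi x ^+ 2 * f x) * B (B g) x =
  (\sum_(x <- s) m x * chi x ^+ 2 * B f x * B g x) + comm f g.
Proof.
rewrite (K_sym_form (fun x => chi x ^+ 2 * f x) (B g)) -big_split /=.
apply: eq_bigr => x _.
have -> : B (fun x => chi x ^+ 2 * f x) x = chi x ^+ 2 * B f x +
    \sum_(y <- s) K x y * (chi y ^+ 2 - chi x ^+ 2) * f y.
  by rewrite /B mulr_sumr -big_split /=; apply: eq_bigr => y _; ring.
rewrite mulrDr mulrDl mulrA; congr +%R.
by rewrite mulr_sumr mulr_suml; apply: eq_bigr => y _; ring.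
Qed.

Let tailE (f : X -> R) : tail f = \sum_(x <- s) m x * ((T x)%:R * f x) ^+ 2.
Proof.
rewrite /tail big_mkcond /=; apply: eq_bigr => x _; rewrite /T.
by case: ifP => _ /=; rewrite ?mul1r // mul0r expr0n mulr0.
Qed.

Let transition x y : K x y != 0 -> chi y - chi x != 0 -> U x.
Proof.
move=> /Kr [h1 h2] h; rewrite /U; apply/andP; split.
  rewrite leqNgt; apply: contra h => h; rewrite !chi1 ?subrr //.
  - exact: ltnW.
  - exact: leq_trans h1 h.
rewrite leqNgt; apply: contra h => h; rewrite !chi0 ?subrr //.
- exact: ltnW.
- by rewrite -ltnS (leq_trans h).
Qed.

Let UT x y : K x y != 0 -> U x -> T y /\ Z y.
Proof.
move=> /Kr [h1 h2] /andP[u1 u2]; rewrite /T /Z; split; first exact: leq_trans h2.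
exact: leq_trans h1 _.
Qed.

(** A self-absorbing estimate: the left side is a pairing of [T g] with [U B g], and Schur's test
    with [lam = beta] bounds it by half of itself plus half of the claimed bound. *)
Lemma annulus_bound (g : X -> R) :
  \sum_(x <- s) m x * ((U x)%:R * B g x) ^+ 2 <= beta ^+ 2 * tail g.
Proof.
set L := (X in X <= _).
(* Row sums are controlled only near the ball of radius [2n], so both indices are truncated to [Z].
   This keeps the symmetry and leaves the rows of the annulus unchanged. *)
pose K' x y := K x y * ((Z x)%:R * (Z y)%:R).
have := @schur_bound R X s m K' beta beta (fun x => (T x)%:R * g x)
  (fun x => (U x)%:R * B g x) m0.
have -> : \sum_(x <- s) \sum_(y <- s)
    m x * K' x y * ((T y)%:R * g y) * ((U x)%:R * B g x) = L.
  apply: eq_bigr => x _.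
  have -> : ((U x)%:R * B g x) ^+ 2 =
      (\sum_(y <- s) K x y * g y) * ((U x)%:R * ((U x)%:R * B g x)).
    by rewrite /B; ring.
  rewrite mulr_suml mulr_sumr; apply: eq_bigr => y _.
  rewrite /K'; case: (eqVneq (K x y) 0) => [->|k0]; first by ring.
  case ux : (U x); last by rewrite !mul0r !mulr0.
  have [-> ->] := UT k0 ux.
  have -> : Z x by move: ux => /andP[_ h]; apply: leq_trans h _.
  by rewrite /=; ring.
have K'sym x y : m x * `|K' x y| = m y * `|K' y x|.
  by rewrite /K' !normrM !mulrA KsymN; ring.
have K'row x : \sum_(y <- s) `|K' x y| <= beta.
  case zx : (Z x).
    apply: le_trans (_ : \sum_(y <- s) `|K x y| <= _).
      apply: ler_sum => y _; rewrite /K' normrM ler_piMr // zx mul1r normr_nat.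
      by case: (Z y); rewrite ?ler01.
    by apply: Krow; apply: leq_trans zx _.
  rewrite big1; first exact: ltW.
  by move=> y _; rewrite /K' zx mul0r mulr0 normr0.
move=> /(_ K'sym K'row beta0); rewrite -tailE -/L => h.
have {}h := le_trans (ler_norm _) h.
have e : beta / 2 * (beta * tail g + L / beta) = (beta ^+ 2 * tail g) / 2 + L / 2.
  by field; rewrite gt_eqF.
by rewrite e in h; lra.
Qed.

(** The first-order part of [chi y ^+ 2 - chi x ^+ 2] has row sums at most [beta / n] and is paired
    with [chi B g], whence the energy. The second-order part has row sums at most [beta / n^2] and
    meets [B g] on the annulus only, where [annulus_bound] applies. *)
Lemma comm_bound (f g : X -> R) (lam : R) : 0 < lam ->
  `|comm f g| <= beta / n%:R * (lam * tail f + energy g / lam) +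
                 (beta / n%:R) ^+ 2 * (tail f + tail g).
Proof.
move=> lam0.
have nR : 0 < n%:R :> R by rewrite ltr0n.
pose K1 x y := K x y * (chi y - chi x).
pose K2 x y := K x y * (chi y - chi x) ^+ 2.
pose f' x := (T x)%:R * f x.
have K1T x y : K1 x y * f' y = K1 x y * f y.
  rewrite /K1 /f'; case: (eqVneq (K x y) 0) => [->|k0]; first by rewrite !mul0r.
  case: (eqVneq (chi y - chi x) 0) => [->|c0]; first by rewrite mulr0 !mul0r.
  by have [-> _] := UT k0 (transition k0 c0); rewrite mul1r.
have K1U x y : K1 x y != 0 -> U x.
  by rewrite /K1 mulf_eq0 => /norP[]; exact: transition.
have -> : comm f g =
   2 * (\sum_(x <- s) \sum_(y <- s) m x * K1 x y * f' y * (chi x * B g x)) +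
   \sum_(x <- s) \sum_(y <- s) m x * K2 x y * f' y * ((U x)%:R * B g x).
  rewrite mulr_sumr -big_split /=; apply: eq_bigr => x _.
  rewrite mulr_sumr -big_split /=; apply: eq_bigr => y _.
  rewrite -(mulrA (m x) (K1 x y)) K1T (_ : K2 x y = K1 x y * (chi y - chi x)); last first.
    by rewrite /K2 /K1; ring.
  rewrite -(mulrA (m x) (K1 x y * (chi y - chi x))) (mulrAC (K1 x y)) K1T.
  case: (eqVneq (K1 x y) 0) => [k0|k0].
    rewrite k0; transitivity (m x * K1 x y * (chi y + chi x) * f y * B g x).
      by rewrite /K1; ring.
    by rewrite k0; ring.
  by rewrite (K1U _ _ k0) /K1 /=; ring.
(* [K1] is antisymmetric with respect to [m]; Schur's test asks for symmetry of the absolute values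
   only. *)
have K1sym x y : m x * `|K1 x y| = m y * `|K1 y x|.
  by rewrite /K1 !normrM !mulrA KsymN distrC.
have K2sym x y : m x * `|K2 x y| = m y * `|K2 y x|.
  by rewrite /K2 !normrM !mulrA KsymN distrC.
have K1row x : \sum_(y <- s) `|K1 x y| <= beta / n%:R.
  case ux : (U x); last first.
    rewrite big1 ?divr_ge0 ?ltW // => y _.
    by case: (eqVneq (K1 x y) 0) => [->|/K1U]; rewrite ?normr0 // ux.
  have xb : (r x <= n.*2.+2)%N by move: ux => /andP[_ h]; rewrite (leq_trans h) //; rewrite -addn2 leq_addr.
  apply: le_trans (_ : \sum_(y <- s) `|K x y| / n%:R <= _); last first.
    by rewrite -mulr_suml ler_wpM2r ?invr_ge0 ?ler0n // Krow.
  apply: ler_sum => y _; rewrite /K1 normrM.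
  case: (eqVneq (K x y) 0) => [->|k0]; first by rewrite normr0 !mul0r.
  by rewrite ler_wpM2l // chiL; have [] := Kr k0.
have K2row x : \sum_(y <- s) `|K2 x y| <= beta / n%:R / n%:R.
  apply: le_trans (_ : \sum_(y <- s) `|K1 x y| / n%:R <= _); last first.
    by rewrite -mulr_suml ler_wpM2r ?invr_ge0 ?ler0n.
  apply: ler_sum => y _; rewrite /K2 /K1 expr2 mulrA normrM.
  case: (eqVneq (K x y) 0) => [->|k0]; first by rewrite !mul0r normr0 !mul0r.
  by rewrite ler_wpM2l // chiL; have [] := Kr k0.
have b1 := @schur_bound R X s m _ _ _ f' (fun x => chi x * B g x) m0 K1sym K1row lam0.
have b2 := @schur_bound R X s m _ _ _ f' (fun x => (U x)%:R * B g x) m0 K2sym K2row beta0.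
apply: le_trans (ler_normD _ _) _; rewrite normrM (ger0_norm (ler0n R 2)).
rewrite -/(energy g) -tailE in b1; rewrite -tailE in b2.
have a := annulus_bound g.
have tf : 0 <= tail f by rewrite sumr_ge0 // => x _; rewrite mulr_ge0 ?sqr_ge0.
have tg : 0 <= tail g by rewrite sumr_ge0 // => x _; rewrite mulr_ge0 ?sqr_ge0.
apply: lerD.
  by apply: le_trans (ler_wpM2l (ler0n R 2) b1) _; rewrite le_eqVlt; apply/orP; left; apply/eqP; field; rewrite !gt_eqF.
apply: le_trans b2 _.
set L := \sum_(_ <- _) _ in a *.
have : L / beta <= beta * tail g by rewrite ler_pdivrMr // (le_trans a) //; rewrite le_eqVlt; apply/orP; left; apply/eqP; ring.
move=> h.
have c0 : 0 <= beta / n%:R / n%:R / 2 by rewrite !divr_ge0 ?ltW.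
apply: le_trans (ler_wpM2l c0 (lerD (lexx (beta * tail f)) h)) _.
have -> : beta / n%:R / n%:R / 2 * (beta * tail f + beta * tail g) =
  (beta / n%:R) ^+ 2 * (tail f + tail g) / 2 by field; rewrite gt_eqF.
have c1 : 0 <= (beta / n%:R) ^+ 2 * (tail f + tail g).
  exact: mulr_ge0 (sqr_ge0 _) (addr_ge0 tf tg).
rewrite ler_pdivrMr ?ltr0n //; move: c1; set Y := _ * (_ + _) => c1; lra.
Qed.

End Commutator.

(** * Finite sums over lists *)

Lemma eq_sum_supp (R : nmodType) (X : eqType) (s1 s2 : seq X) (F : X -> R) :
  uniq s1 -> uniq s2 ->
  (forall x, F x != 0 -> x \in s1) -> (forall x, F x != 0 -> x \in s2) ->
  \sum_(x <- s1) F x = \sum_(x <- s2) F x.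
Proof.
move=> u1 u2 h1 h2.
have E (s : seq X) : \sum_(x <- s) F x = \sum_(x <- [seq x <- s | F x != 0]) F x.
  rewrite big_filter [RHS]big_mkcond /=; apply: eq_bigr => x _.
  by case: eqVneq.
rewrite E [RHS]E; apply: perm_big; apply: uniq_perm; rewrite ?filter_uniq // => x.
by rewrite !mem_filter; case: eqVneq => //= f0; rewrite h1 ?h2.
Qed.

Lemma ler_sum_subset (R : numDomainType) (X : eqType) (s1 s2 : seq X) (F : X -> R) :
  uniq s1 -> {subset s1 <= s2} -> (forall x, 0 <= F x) ->
  \sum_(x <- s1) F x <= \sum_(x <- s2) F x.
Proof.
move=> u1 sub F0; rewrite -(big_rmcond_in (mem s1)) /=; last first.
  by move=> x xs; rewrite xs.
have -> : \sum_(x <- s1 | x \in s1) F x = \sum_(x <- [seq x <- undup s2 | x \in s1]) F x.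
  rewrite -big_filter; apply: perm_big; apply: uniq_perm; rewrite ?filter_uniq ?undup_uniq //.
  move=> x; rewrite !mem_filter mem_undup andbb.
  by case xs : (x \in s1) => //=; rewrite sub.
rewrite big_filter; apply: le_trans (_ : \sum_(x <- undup s2) F x <= _).
  by rewrite big_mkcond /=; apply: ler_sum => x _; case: ifP.
elim: s2 {sub} => [|x s2 ih] /=; first by rewrite big_nil.
case: ifP => _; rewrite !big_cons ?lerD2l //.
by apply: le_trans ih _; rewrite lerDr.
Qed.

(** * Localized estimates for the deficiency equations *)

Definition kop (R : realType) (X : eqType) (K : X -> X -> R) (N : X -> seq X)
  (f : X -> R) (x : X) : R := \sum_(y <- N x) K x y * f y.

(** With [K] the real form of the magnetic Laplacian this is [Delta^2 + W]. The lists [N x] are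
    meant to cover the support of each row, so the operator acts on arbitrary functions. *)
Definition hop (R : realType) (X : eqType) (K : X -> X -> R) (N : X -> seq X)
  (W : X -> R) (f : X -> R) (x : X) : R := kop K N (kop K N f) x + W x * f x.

Section Vanishing.
Variables (R : realType) (X : eqType) (m : X -> R) (K : X -> X -> R).
Variables (N : X -> seq X) (W : X -> R) (r : X -> nat).
Hypotheses (m0 : forall x, 0 < m x).
Hypotheses (Ksym : forall x y, m x * K x y = m y * K y x).
Hypotheses (Kr : forall x y, K x y != 0 -> (r y <= (r x).+1)%N).
Hypotheses (Nu : forall x, uniq (N x)) (KN : forall x y, K x y != 0 -> y \in N x).
Hypotheses (balls : forall n, exists s : seq X, forall x, (r x <= n)%N -> x \in s).

Let Kr2 x y : K x y != 0 -> (r y <= (r x).+1)%N /\ (r x <= (r y).+1)%N.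
Proof.
move=> k0; split; first exact: Kr.
apply: Kr; apply: contraNneq k0 => k0.
by have := Ksym x y; rewrite k0 mulr0 => /eqP; rewrite mulf_eq0 gt_eqF.
Qed.

Section Scale.
Variables (n : nat) (c t : R).
Hypotheses (n0 : (0 < n)%N) (c0 : 0 < c) (t1 : 1 <= t).
Hypotheses (growth : forall x, (r x <= n.*2.+2)%N ->
  \sum_(y <- N x) `|K x y| <= c * n%:R / t /\ - (c * t) <= W x).

(** Truncated subtraction makes the numerator vanish from radius [2n] on: this is
    [min(1, (2 - r/n)^+)]. *)
Let chi x : R := (minn n (n.*2 - r x))%:R / n%:R.

Let nR : 0 < n%:R :> R. Proof. by rewrite ltr0n. Qed.

Let chi_out x : (n.*2 <= r x)%N -> chi x = 0.
Proof. by move=> h; rewrite /chi (_ : minn _ _ = 0%N) ?mul0r //; lia. Qed.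

Let chi_in x : (r x <= n)%N -> chi x = 1.
Proof. by move=> h; rewrite /chi (_ : minn _ _ = n) ?divff ?gt_eqF //; lia. Qed.

Let chi01 x : 0 <= chi x ^+ 2 <= 1.
Proof.
rewrite sqr_ge0 expr_le1 ?divr_ge0 // ler_pdivrMr // mul1r ler_nat; lia.
Qed.

Let chiL x y : (r y <= (r x).+1)%N -> (r x <= (r y).+1)%N ->
  `|chi y - chi x| <= n%:R^-1.
Proof.
move=> h1 h2; rewrite /chi -mulrBl normrM [X in _ * X]ger0_norm ?invr_ge0 ?ler0n //.
rewrite -[leRHS]mul1r ler_wpM2r ?invr_ge0 ?ler0n // ler_norml.
have e1 : (minn n (n.*2 - r x) <= minn n (n.*2 - r y) + 1)%N by lia.
have e2 : (minn n (n.*2 - r y) <= minn n (n.*2 - r x) + 1)%N by lia.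
by move: e1 e2; rewrite -!(ler_nat R) !natrD; lra.
Qed.

Variables (M tau : R).

Section FiniteBall.
Variable s : seq X.
Hypotheses (us : uniq s) (sP : forall x, (r x <= n.*2.+4)%N -> x \in s).
Let B (f : X -> R) x := \sum_(y <- s) K x y * f y.

(** [B] is the kernel truncated to [s]. It agrees with [kop] up to one layer inside radius [2n + 4],
    which leaves room to apply it twice on the ball of radius [2n]. *)
Let kopB f x : (r x <= n.*2.+3)%N -> kop K N f x = B f x.
Proof.
move=> h; apply: eq_sum_supp => // y; rewrite mulf_eq0 => /norP[k0 _].
  exact: KN.
by apply: sP; apply: leq_trans (Kr k0) _.
Qed.

Let hopB f x : (r x <= n.*2)%N -> hop K N W f x = B (B f) x + W x * f x.
Proof.
move=> h; congr (_ + _); rewrite kopB; last by rewrite (leq_trans h) // -addn3 leq_addr.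
apply: eq_bigr => y _; case: (eqVneq (K x y) 0) => [->|k0]; first by rewrite !mul0r.
by rewrite kopB //; apply: leq_trans (Kr k0) _; rewrite ltnS (leq_trans h) // -addn2 leq_addr.
Qed.

Let Brow x : (r x <= n.*2.+2)%N -> \sum_(y <- s) `|K x y| <= c * n%:R / t.
Proof.
move=> h; have [h1 _] := growth h; apply: le_trans h1.
rewrite le_eqVlt; apply/orP; left; apply/eqP; apply: eq_sum_supp => // y; rewrite normr_eq0 => k0.
  by apply: sP; apply: leq_trans (Kr k0) _; rewrite ltnS (leq_trans h) // -addn1 leq_addr.
exact: KN.
Qed.

Let tail (f : X -> R) := \sum_(x <- s | (n <= (r x).+1)%N) m x * f x ^+ 2.
Let energy (g : X -> R) := \sum_(x <- s) m x * (chi x * B g x) ^+ 2.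
Let comm (f g : X -> R) := \sum_(x <- s) \sum_(y <- s)
  m x * K x y * (chi y ^+ 2 - chi x ^+ 2) * f y * B g x.

Let tp : 0 < t. Proof. exact: lt_le_trans ltr01 t1. Qed.
Let beta0 : 0 < c * n%:R / t.
Proof. by rewrite divr_gt0 ?mulr_gt0. Qed.
Let kap0 : 0 < c / t. Proof. by rewrite divr_gt0. Qed.
Let kapc : c / t <= c. Proof. by rewrite ler_pdivrMr // ler_peMr // ltW. Qed.

Let cbound (f g : X -> R) (lam : R) : 0 < lam ->
  `|comm f g| <= c / t * (lam * tail f + energy g / lam) +
                 (c / t) ^+ 2 * (tail f + tail g).
Proof.
move=> lam0.
have := @comm_bound R X s m K r n chi _ (fun x => ltW (m0 x)) Ksym Kr2 n0 beta0
  chi_out chi_in chiL Brow f g lam lam0.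
by rewrite (_ : c * n%:R / t / n%:R = c / t) //; field; rewrite !gt_eqF.
Qed.

Let cform (f g : X -> R) :
  \sum_(x <- s) m x * (chi x ^+ 2 * f x) * B (B g) x =
  (\sum_(x <- s) m x * chi x ^+ 2 * B f x * B g x) + comm f g.
Proof. exact: form_commutator. Qed.

(** Beyond radius [2n], where [B (B g)] need not match [hop], the cut-off is zero. *)
Let weighted_hop (f g : X -> R) :
  \sum_(x <- s) m x * (chi x ^+ 2 * f x) * B (B g) x =
  \sum_(x <- s) m x * chi x ^+ 2 * f x * (hop K N W g x - W x * g x).
Proof.
apply: eq_bigr => x _; case: (leqP n.*2 (r x)) => [/chi_out ->|/ltnW h]; first by ring.
by rewrite hopB //; ring.
Qed.

(* The commutator term is absorbed into half of the energy: lam = 2 c / t in the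
   commutator bound. *)
Lemma energy_le (f g : X -> R) : (forall x, hop K N W f x = g x) ->
  \sum_(x <- s) m x * f x ^+ 2 + \sum_(x <- s) m x * g x ^+ 2 <= M ->
  energy f <= 2 * (1 + c + 4 * c ^+ 2) * t * M.
Proof.
move=> Hf MM; have M0 : 0 <= M.
  by apply: le_trans MM; rewrite addr_ge0 ?sumr_ge0 // => x _; rewrite mulr_ge0 ?sqr_ge0 // ltW.
have fM : \sum_(x <- s) m x * f x ^+ 2 <= M.
  by apply: le_trans MM; rewrite lerDl sumr_ge0 // => x _; rewrite mulr_ge0 ?sqr_ge0 // ltW.
have tM : tail f <= M.
  apply: le_trans fM; rewrite /tail big_mkcond /=; apply: ler_sum => x _.
  by case: ifP => // _; rewrite mulr_ge0 ?sqr_ge0 // ltW.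
have tf0 : 0 <= tail f by rewrite sumr_ge0 // => x _; rewrite mulr_ge0 ?sqr_ge0 // ltW.
have := cform f f; rewrite weighted_hop.
have -> : \sum_(x <- s) m x * chi x ^+ 2 * B f x * B f x = energy f.
  by apply: eq_bigr => x _; ring.
move=> e.
have k20 : 0 < 2 * (c / t) by rewrite mulr_gt0.
have := cbound f f k20; have kc := kapc; have k0 := kap0.
set k := c / t in kc k0 k20 *.
have -> : k * (2 * k * tail f + energy f / (2 * k)) + k ^+ 2 * (tail f + tail f) =
  4 * k ^+ 2 * tail f + energy f / 2 by field; rewrite gt_eqF.
rewrite ler_norml => /andP[cb _].
have k2 : k ^+ 2 * tail f <= c ^+ 2 * M.
  by rewrite ler_pM ?sqr_ge0 // ler_pXn2r ?nnegrE ?(ltW c0) ?(ltW k0).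
(* The part [M] comes from [f g <= f^2 + g^2]; the part [c t M] from the lower bound on [W],
   available wherever the cut-off is nonzero. *)
have W1 : \sum_(x <- s) m x * chi x ^+ 2 * f x * (hop K N W f x - W x * f x) <=
    M + c * t * M.
  apply: le_trans (_ : \sum_(x <- s) (m x * f x ^+ 2 + m x * g x ^+ 2 +
     c * t * (m x * f x ^+ 2)) <= _); last first.
    rewrite big_split -mulr_sumr /= lerD //; first by rewrite big_split.
    by rewrite ler_wpM2l // mulr_ge0 // ltW.
  apply: ler_sum => x _; rewrite Hf.
  have /andP[p0 p1] := chi01 x; set p := _ ^+ 2 in p0 p1 *.
  have -> : m x * p * f x * (g x - W x * f x) =
    m x * (p * (f x * g x) + p * (- W x * f x ^+ 2)) by ring.
  rewrite (_ : m x * f x ^+ 2 + m x * g x ^+ 2 + c * t * (m x * f x ^+ 2) =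
    m x * ((f x ^+ 2 + g x ^+ 2) + c * t * f x ^+ 2)); last by ring.
  rewrite ler_wpM2l ?(ltW (m0 x)) // lerD //.
    have h : f x * g x <= f x ^+ 2 + g x ^+ 2.
      by have := sqr_ge0 (f x - g x); have := sqr_ge0 (f x); have := sqr_ge0 (g x); lra.
    apply: le_trans (ler_wpM2l p0 h) _.
    by rewrite ler_piMl // addr_ge0 ?sqr_ge0.
  rewrite /p; case: (leqP n.*2 (r x)) => [/chi_out ->|h].
    by rewrite expr0n mul0r mulr_ge0 ?sqr_ge0 // mulr_ge0 // ltW.
  have rx : (r x <= n.*2.+2)%N by rewrite (leq_trans (ltnW h)) // -addn2 leq_addr.
  have [_ w] := growth rx.
  have ctf : 0 <= c * t * f x ^+ 2 by rewrite mulr_ge0 ?sqr_ge0 // mulr_ge0 // ltW.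
  apply: le_trans (_ : p * (c * t * f x ^+ 2) <= _); last by rewrite ler_piMl.
  by rewrite -/p ler_wpM2l // ler_wpM2r ?sqr_ge0 //; lra.
have h1 : energy f <= 2 * (1 + c * t + 4 * c ^+ 2) * M.
  move: cb W1 e k2; set S := \sum_(x <- s) _; set Y := comm f f; set E := energy f => cb W1 e k2.
  by lra.
(* Since [t >= 1], the terms free of [t] are absorbed into the factor [t]. *)
apply: le_trans h1 _; rewrite ler_wpM2r //.
have : 0 <= (1 + 4 * c ^+ 2) * (t - 1).
  by rewrite mulr_ge0 ?subr_ge0 // addr_ge0 // mulr_ge0 ?sqr_ge0.
by lra.
Qed.

(** Taking [lam = t L] in the commutator bound balances the errors: the tails contribute [c L tau],
    and the energies, of order [t M], contribute order [M / L]. The parameter [L] stays free, to be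
    fixed before [tau] is made small. *)
Lemma localized_bound (a b : X -> R) (L : R) : 0 < L ->
  (forall x, hop K N W a x = b x) -> (forall x, hop K N W b x = - a x) ->
  \sum_(x <- s) m x * a x ^+ 2 + \sum_(x <- s) m x * b x ^+ 2 <= M ->
  tail a + tail b <= tau ->
  \sum_(x <- s) m x * chi x ^+ 2 * (a x ^+ 2 + b x ^+ 2) <=
    c * L * tau + 2 * c ^+ 2 * tau + 4 * c * (1 + c + 4 * c ^+ 2) * M / L.
Proof.
move=> L0 Ha Hb MM tt.
have -> : \sum_(x <- s) m x * chi x ^+ 2 * (a x ^+ 2 + b x ^+ 2) = comm b a - comm a b.
  have e1 := cform b a; have e2 := cform a b; rewrite !weighted_hop in e1 e2.
  have e3 : \sum_(x <- s) m x * chi x ^+ 2 * B a x * B b x =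
            \sum_(x <- s) m x * chi x ^+ 2 * B b x * B a x.
    by apply: eq_bigr => x _; ring.
  rewrite e3 in e2.
  have -> : comm b a - comm a b = 
   \sum_(x <- s) m x * chi x ^+ 2 * b x * (hop K N W a x - W x * a x) -
   \sum_(x <- s) m x * chi x ^+ 2 * a x * (hop K N W b x - W x * b x).
    by rewrite e1 e2; ring.
  by rewrite -sumrB; apply: eq_bigr => x _; rewrite Ha Hb; ring.
have Ea := energy_le Ha MM.
have Eb : energy b <= 2 * (1 + c + 4 * c ^+ 2) * t * M.
  apply: (@energy_le b (fun x => - a x)) => //.
  by rewrite addrC; under eq_bigr do rewrite sqrrN.
have tL : 0 < t * L by rewrite mulr_gt0.
have := cbound b a tL; rewrite ler_norml => /andP[_ b1].
have := cbound a b tL; rewrite ler_norml => /andP[b2 _].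
set k := 1 + c + 4 * c ^+ 2 in Ea Eb *.
have h : comm b a - comm a b <=
   c / t * (t * L * (tail a + tail b) + (energy a + energy b) / (t * L)) +
   2 * (c / t) ^+ 2 * (tail a + tail b).
  by move: b1 b2; rewrite !mulrDl !mulrDr; lra.
apply: le_trans h _.
have -> : c / t * (t * L * (tail a + tail b) + (energy a + energy b) / (t * L)) =
  c * L * (tail a + tail b) + (c / t) * ((energy a + energy b) / t / L).
  by field; rewrite !gt_eqF.
have t0 : 0 <= tail a + tail b.
  by rewrite addr_ge0 // sumr_ge0 // => x _; rewrite mulr_ge0 ?sqr_ge0 // ltW.
have h1 : c * L * (tail a + tail b) <= c * L * tau by rewrite ler_wpM2l // mulr_ge0 // ltW.
have h2 : (c / t) ^+ 2 * (tail a + tail b) <= c ^+ 2 * tau.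
  by rewrite ler_pM ?sqr_ge0 // ler_pXn2r ?nnegrE ?(ltW c0) ?(ltW kap0) //.
have E0 g : 0 <= energy g by rewrite sumr_ge0 // => x _; rewrite mulr_ge0 ?sqr_ge0 // ltW.
have h3 : (c / t) * ((energy a + energy b) / t / L) <= c * (4 * k * M / L).
  apply: ler_pM kapc _; first exact: ltW.
    exact: divr_ge0 (divr_ge0 (addr_ge0 (E0 a) (E0 b)) (ltW tp)) (ltW L0).
  apply: ler_wpM2r; first by rewrite invr_ge0 ltW.
  by rewrite ler_pdivrMr //; move: Ea Eb; lra.
move: h1 h2 h3; rewrite !mulrA; lra.
Qed.

End FiniteBall.
End Scale.
End Vanishing.

(** * Vanishing of square-summable solutions of the deficiency equations *)

Definition l2_le (R : realType) (X : eqType) (m : X -> R) (f : X -> R) (M : R) :=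
  forall s : seq X, uniq s -> \sum_(x <- s) m x * f x ^+ 2 <= M.

(** Some finite sum, over [s0], comes within [e] of the supremum of all of them, so a list disjoint
    from [s0] can carry at most [e]. *)
Lemma l2_tail (R : realType) (X : eqType) (m f : X -> R) (M e : R) :
  l2_le m f M -> 0 < e -> exists s0 : seq X, forall s, uniq s ->
    (forall x, x \in s -> x \notin s0) -> \sum_(x <- s) m x * f x ^+ 2 <= e.
Proof.
move=> fM e0.
pose S := [set v : R | exists2 s : seq X, uniq s & v = \sum_(x <- s) m x * f x ^+ 2].
have supS : has_sup S.
  split; first by exists 0, [::]; rewrite ?big_nil.
  by exists M => v [s us ->]; exact: fM.
have [v [s0 us0 ->] hv] := sup_adherent e0 supS.
exists s0 => s us dis.
have us' : uniq (s0 ++ s).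
  by rewrite cat_uniq us0 us andbT; apply/hasPn.
have : \sum_(x <- s0 ++ s) m x * f x ^+ 2 <= sup S.
  by apply: sup_ubound; [case: supS | exists (s0 ++ s)].
by rewrite big_cat /=; lra.
Qed.

(** By contradiction at a point of mass [d > 0]: the cut-off is 1 there once [n] is large, while the
    right-hand side of [localized_bound] is brought down to [d / 2]. *)
Lemma deficiency_vanish (R : realType) (X : eqType) (m : X -> R) (K : X -> X -> R)
    (N : X -> seq X) (W : X -> R) (r : X -> nat) (c : R) (n0 : nat)
    (a b : X -> R) (Ma Mb : R) :
  (forall x, 0 < m x) ->
  (forall x y, m x * K x y = m y * K y x) ->
  (forall x y, K x y != 0 -> (r y <= (r x).+1)%N) ->
  (forall x, uniq (N x)) -> (forall x y, K x y != 0 -> y \in N x) ->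
  (forall n, exists s : seq X, forall x, (r x <= n)%N -> x \in s) ->
  0 < c ->
  (forall n, (n0 <= n)%N -> exists2 t : R, 1 <= t & forall x, (r x <= n.*2.+2)%N ->
    \sum_(y <- N x) `|K x y| <= c * n%:R / t /\ - (c * t) <= W x) ->
  l2_le m a Ma -> l2_le m b Mb ->
  (forall x, hop K N W a x = b x) -> (forall x, hop K N W b x = - a x) ->
  forall x, a x = 0.
Proof.
move=> m0 Ksym Kr Nu KN balls c0 growth aM bM Ha Hb x.
case: (eqVneq (a x) 0) => // ax; exfalso.
pose d := m x * a x ^+ 2.
have d0 : 0 < d by rewrite mulr_gt0 // exprn_even_gt0.
have sq0 (f : X -> R) y : 0 <= m y * f y ^+ 2 by rewrite mulr_ge0 ?sqr_ge0 // ltW.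
have Ma0 : 0 <= Ma by have := aM [::] isT; rewrite big_nil.
have Mb0 : 0 <= Mb by have := bM [::] isT; rewrite big_nil.
pose k := 4 * c * (1 + c + 4 * c ^+ 2).
have k0 : 0 < k by rewrite /k mulr_gt0 ?mulr_gt0 // addr_gt0 ?addr_gt0 ?mulr_gt0 ?exprn_gt0.
(* The order of choices matters: [L] makes the term in [1 / L] at most [d / 4], then [tau] makes the
   two tail terms add up to [d / 4], and only then [n] is taken large enough for the tails. *)
pose L := 4 * (k * (Ma + Mb)) / d + 1.
have L0 : 0 < L.
  by rewrite ltr_wpDl // divr_ge0 ?(ltW d0) // mulr_ge0 // mulr_ge0 ?addr_ge0 // ltW.
pose tau := d / (4 * (c * L + 2 * c ^+ 2)).
have D0 : 0 < c * L + 2 * c ^+ 2 by rewrite addr_gt0 ?mulr_gt0 ?exprn_gt0.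
have tau0 : 0 < tau / 2 by rewrite divr_gt0 // divr_gt0 // mulr_gt0.
have [sa tail_a] := l2_tail aM tau0.
have [sb tail_b] := l2_tail bM tau0.
(* The sums dominate every radius occurring in [sa] and [sb]; the offset 2 places all points with
   [r >= n - 1], where the tails live, outside both lists. *)
pose n := (n0 + r x + \sum_(y <- sa) r y + \sum_(y <- sb) r y).+2.
have n_gt0 : (0 < n)%N by [].
have [t t1 gr] : exists2 t : R, 1 <= t & forall x, (r x <= n.*2.+2)%N ->
    \sum_(y <- N x) `|K x y| <= c * n%:R / t /\ - (c * t) <= W x.
  by apply: growth; rewrite /n -!addnA -addnS -addnS leq_addr.
have [s0 s0P] := balls (n.*2.+4).
pose s := undup s0.
have us : uniq s by exact: undup_uniq.
have sP y : (r y <= n.*2.+4)%N -> y \in s by move=> h; rewrite mem_undup s0P.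
have le_mem (s' : seq X) y : y \in s' -> (r y <= \sum_(z <- s') r z)%N.
  elim: s' => // z s' ih; rewrite inE big_cons => /orP[/eqP ->|/ih h].
    exact: leq_addr.
  by rewrite (leq_trans h) ?leq_addl.
have out y s' : (\sum_(z <- s') r z <= n.-2)%N -> (n <= (r y).+1)%N -> y \notin s'.
  by move=> h1 h2; apply/negP => /le_mem h3; move: h1 h2 h3; rewrite /n /=; clear; lia.
have tails : \sum_(y <- s | (n <= (r y).+1)%N) m y * a y ^+ 2 +
             \sum_(y <- s | (n <= (r y).+1)%N) m y * b y ^+ 2 <= tau.
  have -> : tau = tau / 2 + tau / 2 by field.
  rewrite -!(big_filter s); apply: lerD.
    apply: tail_a; rewrite ?filter_uniq // => y; rewrite mem_filter => /andP[h _].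
    by apply: out h; rewrite /n /=; clear; lia.
  apply: tail_b; rewrite ?filter_uniq // => y; rewrite mem_filter => /andP[h _].
  by apply: out h; rewrite /n /=; clear; lia.
have := @localized_bound R X m K N W r m0 Ksym Kr Nu KN n c t n_gt0 c0 t1 gr
  (Ma + Mb) tau s us sP a b L L0 Ha Hb (lerD (aM s us) (bM s us)) tails.
have lower : d <= \sum_(y <- s) m y *
    ((minn n (n.*2 - r y))%:R / n%:R) ^+ 2 * (a y ^+ 2 + b y ^+ 2).
  have rx : (r x <= n)%N by rewrite /n; clear; lia.
  apply: le_trans (@ler_sum_subset _ _ [:: x] _ _ isT _ _).
  - rewrite big_cons big_nil addr0 (_ : minn _ _ = n); last by move: rx; clear; lia.
    rewrite divff ?pnatr_eq0 // expr1n mulr1 mulrDr lerDl //; exact: sq0.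
  - by move=> y; rewrite inE => /eqP ->; apply: sP; move: rx; clear; lia.
  - by move=> y; rewrite mulr_ge0 ?addr_ge0 ?sqr_ge0 // mulr_ge0 ?sqr_ge0 // ltW.
move/(le_trans lower).
have -> : c * L * tau + 2 * c ^+ 2 * tau = d / 4.
  rewrite -mulrDl /tau; set D := c * L + _ in D0 *.
  by field; rewrite gt_eqF.
rewrite -/k => h.
have : k * (Ma + Mb) / L <= d / 4.
  rewrite ler_pdivrMr // /L (mulrDr (d / 4)) mulr1.
  have -> : d / 4 * (4 * (k * (Ma + Mb)) / d) = k * (Ma + Mb) by field; rewrite gt_eqF.
  by rewrite lerDl ltW // divr_gt0.
by lra.
Qed.

(** * Approximation in the graph norm *)

Section FiniteSupport.
Variables (R : realType) (X : eqType) (m : X -> R) (K : X -> X -> R).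
Variables (N : X -> seq X) (W : X -> R).
Hypotheses (m0 : forall x, 0 < m x).
Hypotheses (Ksym : forall x y, m x * K x y = m y * K y x).
Hypotheses (Nu : forall x, uniq (N x)) (KN : forall x y, K x y != 0 -> y \in N x).

Definition supported (f : X -> R) (s : seq X) := forall x, f x != 0 -> x \in s.

Let Ksym0 x y : K x y != 0 -> K y x != 0.
Proof.
apply: contraNneq => k0.
by have := Ksym x y; rewrite k0 mulr0 => /eqP; rewrite mulf_eq0 gt_eqF.
Qed.

Lemma supported_kop f s : supported f s -> supported (kop K N f) (flatten (map N s)).
Proof.
move=> fs x; apply: contraR => xs; rewrite /kop big1_seq // => y /andP[_ yN].
case: (eqVneq (K x y) 0) => [->|/Ksym0 k0]; first by rewrite mul0r.
case: (eqVneq (f y) 0) => [->|f0]; first by rewrite mulr0.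
case/negP: xs; apply/flattenP; exists (N y); last exact: KN.
by apply: map_f; exact: fs.
Qed.

Lemma supported_hop f s : supported f s ->
  supported (hop K N W f) (s ++ flatten (map N (flatten (map N s)))).
Proof.
move=> fs x; rewrite mem_cat /hop.
case: (eqVneq (f x) 0) => [-> | /fs ->//].
by rewrite mulr0 addr0 => /(supported_kop (supported_kop fs)) ->; rewrite orbT.
Qed.

(** Both sides equal one double sum over [s'], which contains the support of [f] and the neighbours
    of that support. *)
Lemma kop_adj f g s s' : supported f s ->
  {subset s ++ flatten (map N s) <= s'} -> uniq s' ->
  \sum_(x <- s') m x * kop K N f x * g x = \sum_(x <- s') m x * f x * kop K N g x.
Proof.
move=> fs sub us.
transitivity (\sum_(x <- s') \sum_(y <- s') m x * K x y * f y * g x).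
  apply: eq_bigr => x _.
  rewrite [kop _ _ _ _](_ : _ = \sum_(y <- s') K x y * f y); last first.
    apply: eq_sum_supp => // y; rewrite mulf_eq0 => /norP[k0 f0]; first exact: KN.
    by apply: sub; rewrite mem_cat fs.
  by rewrite mulr_sumr mulr_suml; apply: eq_bigr => y _; ring.
rewrite exchange_big /=; apply: eq_bigr => x _.
case: (eqVneq (f x) 0) => [->|f0].
  by rewrite mulr0 mul0r big1 // => y _; rewrite mulr0 mul0r.
rewrite [kop _ _ _ _](_ : _ = \sum_(y <- s') K x y * g y); last first.
  apply: eq_sum_supp => // y; rewrite mulf_eq0 => /norP[k0 g0]; first exact: KN.
  apply: sub; rewrite mem_cat; apply/orP; right.
  by apply/flattenP; exists (N x); [apply/map_f/fs | exact: KN].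
by rewrite mulr_sumr; apply: eq_bigr => y _; rewrite -Ksym; ring.
Qed.

(* [g] is arbitrary: only [f] has finite support. *)
Lemma hop_adj f g s s' : supported f s -> 
  {subset s ++ flatten (map N s) ++ flatten (map N (flatten (map N s))) <= s'} ->
  uniq s' ->
  \sum_(x <- s') m x * hop K N W f x * g x = \sum_(x <- s') m x * f x * hop K N W g x.
Proof.
move=> fs sub us; rewrite /hop.
transitivity (\sum_(x <- s') m x * kop K N (kop K N f) x * g x +
   \sum_(x <- s') m x * f x * (W x * g x)).
  by rewrite -big_split; apply: eq_bigr => x _ /=; ring.
rewrite (kop_adj _ (supported_kop fs)) //; last first.
  by move=> x xs; apply: sub; rewrite mem_cat xs orbT.
rewrite (kop_adj _ fs) //; last first.
  move=> x xs; apply: sub; move: xs; rewrite !mem_cat => /orP[]-> //; by rewrite orbT.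
by rewrite -big_split; apply: eq_bigr => x _ /=; ring.
Qed.

Lemma hop_lin f g t x :
  hop K N W (fun y => f y + t * g y) x = hop K N W f x + t * hop K N W g x.
Proof.
have kl (u v : X -> R) z : kop K N (fun y => u y + t * v y) z = kop K N u z + t * kop K N v z.
  by rewrite /kop mulr_sumr -big_split /=; apply: eq_bigr => y _; ring.
rewrite /hop (_ : kop K N (fun y => f y + t * g y) = (fun y => kop K N f y + t * kop K N g y)).
  by rewrite kl; ring.
by apply/funext => z; exact: kl.
Qed.

Lemma hop_sub f g x : hop K N W (fun y => f y - g y) x = hop K N W f x - hop K N W g x.
Proof.
rewrite -[- hop _ _ _ g x]mulN1r -hop_lin; congr hop.
by apply/funext => y; rewrite mulN1r.
Qed.

Lemma cvg_lincomb (s : seq X) (w : X -> R) (f : nat -> X -> R) (g : X -> R) :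
  (forall x, f n x @[n --> \oo] --> g x) ->
  \sum_(x <- s) w x * f n x @[n --> \oo] --> \sum_(x <- s) w x * g x.
Proof.
move=> fg; apply: cvg_big => [|x _]; first exact: add_continuous.
exact: cvgM (cvg_cst _) (fg x).
Qed.

(** Each value of [hop] is a finite combination of values of its argument, so pointwise convergence
    suffices. *)
Lemma hop_cvg (f : nat -> X -> R) (g : X -> R) :
  (forall x, f n x @[n --> \oo] --> g x) ->
  forall x, hop K N W (f n) x @[n --> \oo] --> hop K N W g x.
Proof.
move=> fg x; apply: cvgD; last exact: cvgM (cvg_cst _) (fg x).
apply: cvg_lincomb => y; exact: cvg_lincomb.
Qed.

End FiniteSupport.

Lemma cvg_le_harmonic (R : realType) (u : nat -> R) (l C D : R) :
  u n @[n --> \oo] --> l -> (forall n, u n <= C + D * n.+1%:R^-1) -> l <= C.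
Proof.
move=> ul uC; have h : C + D * n.+1%:R^-1 @[n --> \oo] --> C.
  rewrite -[X in _ --> X]addr0 -[X in _ + X](mulr0 D).
  by apply: cvgD; [exact: cvg_cst | apply: cvgM; [exact: cvg_cst | exact: cvg_harmonic]].
by apply: ler_cvg_to ul h _; near=> n.
Unshelve. all: by end_near. Qed.

(** * Minimising the graph distance to the finitely supported functions *)

Section Approximation.
Variables (R : realType) (X : eqType) (m : X -> R) (K : X -> X -> R).
Variables (N : X -> seq X) (W : X -> R).
Hypotheses (m0 : forall x, 0 < m x).
Hypotheses (Ksym : forall x y, m x * K x y = m y * K y x).
Hypotheses (Nu : forall x, uniq (N x)) (KN : forall x y, K x y != 0 -> y \in N x).
Hypothesis vanish : forall (a b : X -> R) (Ma Mb : R), l2_le m a Ma -> l2_le m b Mb ->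
  (forall x, hop K N W a x = b x) -> (forall x, hop K N W b x = - a x) ->
  forall x, a x = 0.
Variables (v : X -> R) (Mv Mw : R).
Hypotheses (vM : l2_le m v Mv) (wM : l2_le m (hop K N W v) Mw).

Let H := hop K N W.
Let q (f : X -> R) x := m x * (f x ^+ 2 + H f x ^+ 2).
Let fs (f : X -> R) := exists s, supported f s.
Let gle (f : X -> R) M := forall s : seq X, uniq s -> \sum_(x <- s) q f x <= M.

Let q0 f x : 0 <= q f x.
Proof. by rewrite mulr_ge0 ?addr_ge0 ?sqr_ge0 // ltW. Qed.

(** Here [q] is the density of the squared graph norm, so the infimum [I] of these upper bounds is
    the squared graph distance from [v] to the finitely supported functions. *)
Let S := [set M : R | exists2 u, fs u & gle (fun x => v x - u x) M].

Let S_inf : has_inf S.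
Proof.
split; last first.
  by exists 0 => M [u _ /(_ [::] isT)]; rewrite big_nil.
exists (Mv + Mw), (fun=> 0); first by exists [::] => x; rewrite eqxx.
move=> s us; rewrite (_ : (fun x => v x - 0) = v); last by apply/funext => x; rewrite subr0.
apply: le_trans (lerD (vM us) (wM us)); rewrite -big_split /=.
by apply: ler_sum => x _; rewrite /q mulrDr.
Qed.

Let I := inf S.

Let near_inf e : 0 < e -> exists2 u, fs u & gle (fun x => v x - u x) (I + e).
Proof.
move=> e0; have [M [u fu gu] hM] := inf_adherent e0 S_inf.
by exists u => // s us; apply: le_trans (gu s us) (ltW hM).
Qed.

(** Otherwise [I - e] would bound all finite sums for [u], hence belong to [S]. *)
Let far_inf u e : fs u -> 0 < e ->
  exists2 s, uniq s & I - e <= \sum_(x <- s) q (fun x => v x - u x) x.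
Proof.
move=> fu e0; apply: contrapT => no.
have : S (I - e).
  exists u => // s us; rewrite leNgt; apply/negP => lt; apply: no; exists s => //.
  exact: ltW.
by move/(ge_inf S_inf.2); rewrite -/I; lra.
Qed.

Let far_inf_sup u e (s0 : seq X) : fs u -> 0 < e ->
  exists s : seq X, [/\ uniq s, {subset s0 <= s} &
   I - e <= \sum_(x <- s) q (fun x => v x - u x) x].
Proof.
move=> fu e0; have [s us hs] := far_inf fu e0.
exists (undup (s ++ s0)); split; rewrite ?undup_uniq //.
  by move=> x xs; rewrite mem_undup mem_cat xs orbT.
apply: le_trans hs (ler_sum_subset us _ (q0 _)) => x xs.
by rewrite mem_undup mem_cat xs.
Qed.

(** Near-minimisers are close to each other: the parallelogram identity gives at most
    [2 (I + e) + 2 (I + e) - 4 (I - e) = 8 e]. *)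
Let parallelogram u1 u2 e : fs u1 -> fs u2 -> 0 < e ->
  gle (fun x => v x - u1 x) (I + e) -> gle (fun x => v x - u2 x) (I + e) ->
  gle (fun x => (v x - u1 x) - (v x - u2 x)) (8 * e).
Proof.
move=> [s1 f1] [s2 f2] e0 g1 g2 s' us'.
pose u3 x := 2^-1 * (u1 x + u2 x).
have [s [us sub hs]] : exists s : seq X, [/\ uniq s, {subset s' <= s} &
   I - e <= \sum_(x <- s) q (fun x => v x - u3 x) x].
  apply: far_inf_sup => //; exists (s1 ++ s2) => x; rewrite /u3 mem_cat.
  case: (eqVneq (u1 x) 0) => [->|/f1 ->//]; rewrite add0r.
  by case: (eqVneq (u2 x) 0) => [->|/f2 ->]; rewrite ?mulr0 ?eqxx ?orbT.
apply: le_trans (ler_sum_subset us' sub (q0 _)) _.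
(* The midpoint [v - u3] has graph norm at least [I - e]. *)
have E : \sum_(x <- s) q (fun x => v x - u1 x - (v x - u2 x)) x =
  2 * \sum_(x <- s) q (fun x => v x - u1 x) x + 2 * \sum_(x <- s) q (fun x => v x - u2 x) x
  - 4 * \sum_(x <- s) q (fun x => v x - u3 x) x.
  rewrite !mulr_sumr -big_split -sumrB /=; apply: eq_bigr => x _.
  rewrite /q /H !hop_sub (_ : hop K N W u3 x = 2^-1 * (H u1 x + H u2 x)).
    by rewrite /u3 /H; field.
  rewrite (_ : u3 = (fun y => u1 y + 2^-1 * (u2 y - u1 y))); last first.
    by apply/funext => y; rewrite /u3; field.
  by rewrite hop_lin hop_sub /H; field.
rewrite E; have := g1 s us; have := g2 s us; lra.
Qed.

(** First variation at a near-minimiser: the squared distance is at most [I + e] at [u] and at least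
    [I] at [u + t phi], the latter seen by finite sums up to [e]. Expanding the square gives the
    claim. *)
Let almost_orth u phi s0 e t : fs u -> 0 < e -> gle (fun x => v x - u x) (I + e) ->
  supported phi s0 -> supported (H phi) s0 -> uniq s0 ->
  2 * t * (\sum_(x <- s0) (m x * phi x * (v x - u x) + m x * H phi x * H (fun y => v y - u y) x))
  <= t ^+ 2 * \sum_(x <- s0) q phi x + 2 * e.
Proof.
move=> [su fu] e0 gu p0 Hp0 us0.
have fu' : fs (fun x => u x + t * phi x).
  exists (su ++ s0) => x; rewrite mem_cat.
  case: (eqVneq (u x) 0) => [->|/fu ->//]; rewrite add0r.
  by case: (eqVneq (phi x) 0) => [->|/p0 ->]; rewrite ?mulr0 ?eqxx ?orbT.
have [s [us sub hs]] := far_inf_sup s0 fu' e0.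
have gs := gu s us.
have restr (F : X -> R) : (forall x, F x != 0 -> x \in s0) ->
  \sum_(x <- s0) F x = \sum_(x <- s) F x.
  by move=> F0; apply: eq_sum_supp => // x /F0; exact: sub.
rewrite restr; last first.
  move=> x; case: (eqVneq (phi x) 0) => [->|/p0 ->//].
  case: (eqVneq (H phi x) 0) => [->|/Hp0 ->//].
  by rewrite !mulr0 !mul0r addr0 eqxx.
rewrite restr; last first.
  move=> x; rewrite /q; case: (eqVneq (phi x) 0) => [->|/p0 ->//].
  case: (eqVneq (H phi x) 0) => [->|/Hp0 ->//].
  by rewrite expr0n addr0 mulr0 eqxx.
have E : \sum_(x <- s) q (fun x => v x - (u x + t * phi x)) x =
  \sum_(x <- s) q (fun x => v x - u x) x -
  2 * t * \sum_(x <- s) (m x * phi x * (v x - u x) + m x * H phi x * H (fun y => v y - u y) x)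
  + t ^+ 2 * \sum_(x <- s) q phi x.
  rewrite !mulr_sumr -sumrB -big_split /=; apply: eq_bigr => x _.
  by rewrite /q /H !hop_sub hop_lin; ring.
by rewrite E in hs; lra.
Qed.

Lemma graph_approx e : 0 < e -> exists u s, [/\ supported u s,
  l2_le m (fun x => v x - u x) e & l2_le m (fun x => H v x - H u x) e].
Proof.
pose eps n : R := n.+1%:R^-1.
have eps0 n : 0 < eps n by rewrite invr_gt0 ltr0n.
have [u uP] := choice (fun n => (fun P => let: ex_intro2 u a b := P in
  ex_intro (fun u => fs u /\ gle (fun x => v x - u x) (I + eps n)) u (conj a b))
    (near_inf (eps0 n))).
pose d n x := v x - u n x.
have epsle n k : (n <= k)%N -> eps k <= eps n.
  by move=> nk; rewrite lef_pV2 ?posrE ?ltr0n // ler_nat.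
have cauchy_d n k : (n <= k)%N -> gle (fun x => d n x - d k x) (8 * eps n).
  move=> nk; have [fn gn] := uP n; have [fk gk] := uP k.
  apply: parallelogram => // s us; apply: le_trans (gk s us) _.
  by rewrite lerD2l epsle.
have d_cvg x : cvgn (fun n => d n x).
  (* A one-point sum of the graph-norm estimate controls the value at [x], because [m x > 0]. *)
  apply/cauchy_cvgP; apply: cauchy_exP => e' e'0.
  have c0 : 0 < 8 / (m x * e' ^+ 2) by rewrite divr_gt0 ?mulr_gt0 ?exprn_gt0.
  have [n0 hn0] : exists n0 : nat, 8 / (m x * e' ^+ 2) < n0.+1%:R.
    exists (Num.truncn (8 / (m x * e' ^+ 2))); exact: truncnS_gt.
  exists (d n0 x); exists n0 => // k /= nk; rewrite /ball /=.
  have := cauchy_d _ _ nk [:: x] isT; rewrite big_cons big_nil addr0 /q => h.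
  have : m x * (d n0 x - d k x) ^+ 2 < m x * e' ^+ 2.
    apply: le_lt_trans (_ : 8 * eps n0 < _).
      by apply: le_trans h; rewrite ler_wpM2l ?(ltW (m0 x)) // lerDl sqr_ge0.
    rewrite /eps ltr_pdivrMr ?ltr0n //; move: hn0; rewrite ltr_pdivrMr ?mulr_gt0 ?exprn_gt0 //.
    by rewrite mulrC.
  rewrite ltr_pM2l // -[X in X < _]real_normK ?num_real // ltr_pXn2r ?nnegrE //.
  exact: ltW.
pose a x := limn (fun n => d n x).
have da x : d n x @[n --> \oo] --> a x by exact: d_cvg.
have Hda := hop_cvg da.
(* Bounds on finite sums survive the pointwise limit in [k]. *)
have lim_gle n : gle (fun x => d n x - a x) (8 * eps n).
  move=> s us; have : \sum_(x <- s) q (fun x => d n x - d k x) x @[k --> \oo] -->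
      \sum_(x <- s) q (fun x => d n x - a x) x.
    apply: cvg_big => [|x _]; first exact: add_continuous.
    have dx : (fun y => d n y - d k y) x @[k --> \oo] --> d n x - a x.
      by apply: cvgB; [exact: cvg_cst | exact: da].
    have Hdx : H (fun y => d n y - d k y) x @[k --> \oo] --> H (fun y => d n y - a y) x.
      by apply: hop_cvg => y; apply: cvgB; [exact: cvg_cst | exact: da].
    apply: cvgM; first exact: cvg_cst.
    by apply: cvgD; rewrite expr2; apply: cvgM.
  move/cvgr_to_le; apply; exists n => // k /= nk; exact: cauchy_d.
have sq2 (y z : R) : y ^+ 2 <= 2 * z ^+ 2 + 2 * (z - y) ^+ 2.
  by have := sqr_ge0 (2 * z - y); lra.
have a_gle : gle a (2 * (I + eps 0) + 2 * (8 * eps 0)).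
  move=> s us; have [_ /(_ s us) h1] := uP 0%N; have h2 := lim_gle 0%N s us.
  apply: le_trans (_ : 2 * \sum_(x <- s) q (d 0%N) x +
     2 * \sum_(x <- s) q (fun x => d 0%N x - a x) x <= _); last by rewrite lerD // ler_wpM2l.
  rewrite !mulr_sumr -big_split /=; apply: ler_sum => x _.
  rewrite /q /H (hop_sub K N W (d 0%N) a x) -/H; have h3 := sq2 (a x) (d 0%N x); have h4 := sq2 (H a x) (H (d 0%N) x).
  have := lerD h3 h4 => /(ler_wpM2l (ltW (m0 x))) h; apply: le_trans h _.
  by rewrite le_eqVlt; apply/orP; left; apply/eqP; ring.
(* Orthogonality to the indicator [phi] of [z] reads [m z * (a z + H (H a) z) = 0] once [H] is moved
   off [phi]. *)
have HHa z : H (H a) z = - a z.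
  pose phi x : R := (x == z)%:R.
  have phis : supported phi [:: z] by move=> x; rewrite /phi inE; case: (x == z); rewrite ?eqxx.
  pose s0 := undup ([:: z] ++ flatten (map N [:: z]) ++ flatten (map N (flatten (map N [:: z])))).
  have us0 : uniq s0 by exact: undup_uniq.
  have zs0 : z \in s0 by rewrite mem_undup inE eqxx.
  have phis0 : supported phi s0 by move=> x /phis; rewrite inE => /eqP ->.
  have Hphis0 : supported (H phi) s0.
    move=> x /(supported_hop m0 Ksym KN phis); rewrite mem_undup !mem_cat.
    by case/orP => -> //; rewrite !orbT.
  pose Phi f := \sum_(x <- s0) (m x * phi x * f x + m x * H phi x * H f x).
  have Phi_cvg : Phi (d n) @[n --> \oo] --> Phi a.
    apply: cvg_big => [|x _]; first exact: add_continuous.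
    by apply: cvgD; (apply: cvgM; first exact: cvg_cst); [exact: da | exact: Hda].
  pose Q := \sum_(x <- s0) q phi x.
  have Q0 : 0 <= Q by apply: sumr_ge0 => x _; exact: q0.
  have ineq t : 2 * t * Phi a <= t ^+ 2 * Q.
    apply: (@cvg_le_harmonic _ (fun n => 2 * t * Phi (d n)) _ _ 2).
      by apply: cvgM => //; exact: cvg_cst.
    by move=> n; have [fn gn] := uP n; exact: (almost_orth t fn (eps0 n) gn phis0 Hphis0 us0).
  have Phia0 : Phi a = 0.
    apply/eqP; rewrite -sqrf_eq0 eq_le sqr_ge0 andbT.
    (* The inequality holds for every [t]; this choice yields [(Q + 2) * Phi a ^+ 2 <= 0], and
       [Q + 1] avoids a division by zero. *)
    have := ineq (Phi a / (Q + 1)); have Q1 : 0 < Q + 1 by lra.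
    rewrite expr_div_n.
    rewrite (_ : 2 * (Phi a / (Q + 1)) * Phi a = (2 * (Q + 1) * Phi a ^+ 2) / (Q + 1) ^+ 2); last first.
      by field; rewrite gt_eqF.
    rewrite (mulrAC _ _ Q) ler_pM2r ?invr_gt0 ?exprn_gt0 // => h.
    have : (Q + 2) * Phi a ^+ 2 <= 0 by lra.
    by rewrite pmulr_rle0 //; lra.
  have : Phi a = m z * (a z + H (H a) z).
    rewrite /Phi big_split /= /H (@hop_adj _ _ _ _ _ W m0 Ksym Nu KN _ _ [:: z]) //; last first.
      by move=> x xs; rewrite mem_undup.
    have pick (f : X -> R) : \sum_(x <- s0) m x * phi x * f x = m z * f z.
      rewrite (bigD1_seq z) //= /phi eqxx mulr1 big1 ?addr0 // => x /negPf ->.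
      by rewrite mulr0 mul0r.
    by rewrite !pick -mulrDr.
  rewrite Phia0 => /esym/eqP; rewrite mulf_eq0 gt_eqF //= addrC addr_eq0 => /eqP.
  by [].
have split1 f M : gle f M -> l2_le m f M.
  move=> gf s us; apply: le_trans (gf s us); apply: ler_sum => x _.
  by rewrite ler_wpM2l ?(ltW (m0 x)) // lerDl sqr_ge0.
have split2 f M : gle f M -> l2_le m (H f) M.
  move=> gf s us; apply: le_trans (gf s us); apply: ler_sum => x _.
  by rewrite ler_wpM2l ?(ltW (m0 x)) // lerDr sqr_ge0.
(* The pair [a], [H a] solves the deficiency equations, so the limit is zero and [d n] itself is
   small in the graph norm. *)
have a0 := vanish (split1 _ _ a_gle) (split2 _ _ a_gle) (fun=> erefl) HHa.
move=> e0.
have [n hn] : exists n : nat, 8 / e < n.+1%:R.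
  exists (Num.truncn (8 / e)); exact: truncnS_gt.
have le_e : 8 * eps n <= e.
  by rewrite ler_pdivrMr ?ltr0n // mulrC -ler_pdivrMr // ltW.
have dn_gle : gle (d n) e.
  move=> s us; have := lim_gle n s us; rewrite (_ : (fun x => d n x - a x) = d n).
    by move/le_trans; apply.
  by apply/funext => x; rewrite a0 subr0.
have [[s us] _] := uP n.
exists (u n), s; split => //; first exact: split1.
by have := split2 _ _ dn_gle; rewrite (_ : H (d n) = (fun x => H v x - H (u n) x)) //;
  apply/funext => x; exact: hop_sub.
Qed.

End Approximation.

(** * Complex functions as real functions on [V * bool] *)

Lemma esum_leP (R : realType) (V : choiceType) (G : V -> R) (M : R) :
  (\esum_(x in [set: V]) (G x)%:E <= M%:E)%E <->
  forall s : seq V, uniq s -> \sum_(x <- s) G x <= M.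
Proof.
split=> [h s us|h].
  rewrite -lee_fin -sumEFin; apply: le_trans h; apply: esum_ge.
  by exists [set` s] => //; rewrite -fsbig_seq.
apply: ge_ereal_sup => _ [A [finA _] <-].
by rewrite fsbig_finite // sumEFin lee_fin; apply: h; exact: fset_uniq.
Qed.

Lemma esum_real (R : realType) (V : choiceType) (G : V -> R) (M : R) :
  (forall x, 0 <= G x) -> (forall s : seq V, uniq s -> \sum_(x <- s) G x <= M) ->
  let p := fine (\esum_(x in [set: V]) (G x)%:E) in
  (forall s : seq V, uniq s -> \sum_(x <- s) G x <= p) /\
  (forall e, 0 < e -> exists2 s : seq V, uniq s & p - e <= \sum_(x <- s) G x).
Proof.
move=> G0 /esum_leP GM p.
have Ep : \esum_(x in [set: V]) (G x)%:E = p%:E.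
  rewrite /p fineK // ge0_fin_numE; last by apply: esum_ge0 => x _; rewrite lee_fin.
  exact: le_lt_trans GM (ltry _).
split=> [|e e0]; first by apply/esum_leP; rewrite Ep.
apply: contrapT => no; have : (\esum_(x in [set: V]) (G x)%:E <= (p - e)%:E)%E.
  apply/esum_leP => s us; rewrite leNgt; apply/negP => lt; apply: no; exists s => //.
  exact: ltW.
by rewrite Ep lee_fin; lra.
Qed.

(** The sums of the positive and of the negative parts are nearly attained on finite lists, and one
    list containing these and [s0] serves both. The bound [M] keeps both sums finite, so [fine]
    never returns its default. *)
Lemma rsum_near (R : realType) (V : countType) (F : V -> R) (M c e : R) (s0 : seq V) :
  (forall s : seq V, uniq s -> \sum_(x <- s) `|F x| <= M) ->
  (forall s : seq V, uniq s -> {subset s0 <= s} -> `|\sum_(x <- s) F x - c| <= e) ->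
  `|rsum F - c| <= e.
Proof.
move=> FM near; apply/ler_addgt0Pr => d d0.
have max0 (x : R) : 0 <= Num.max x 0 by rewrite le_max lexx orbT.
have maxM (G : V -> R) : (forall x, `|G x| = `|F x|) ->
    forall s : seq V, uniq s -> \sum_(x <- s) Num.max (G x) 0 <= M.
  move=> GF s us; apply: le_trans (FM s us); apply: ler_sum => x _.
  by rewrite -GF ge_max normr_ge0 ler_norm.
have [ub1 lb1] := esum_real (fun x => max0 (F x)) (maxM F (fun=> erefl)).
have [ub2 lb2] := esum_real (fun x => max0 (- F x)) (maxM (fun x => - F x) (fun x => normrN _)).
rewrite /rsum; move: ub1 lb1 ub2 lb2; set p1 := fine _; set p2 := fine _ => ub1 lb1 ub2 lb2.
have [s1 us1 h1] := lb1 _ d0; have [s2 us2 h2] := lb2 _ d0.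
pose s := undup (s0 ++ s1 ++ s2).
have us : uniq s by exact: undup_uniq.
have sub0 : {subset s0 <= s} by move=> x xs; rewrite mem_undup mem_cat xs.
have sub1 : {subset s1 <= s} by move=> x xs; rewrite mem_undup !mem_cat xs orbT.
have sub2 : {subset s2 <= s} by move=> x xs; rewrite mem_undup !mem_cat xs !orbT.
have g1 := le_trans h1 (ler_sum_subset us1 sub1 (fun x => max0 (F x))).
have g2 := le_trans h2 (ler_sum_subset us2 sub2 (fun x => max0 (- F x))).
have := near s us sub0; have := ub1 s us; have := ub2 s us.
have -> : \sum_(x <- s) F x =
    \sum_(x <- s) Num.max (F x) 0 - \sum_(x <- s) Num.max (- F x) 0.
  rewrite -sumrB; apply: eq_bigr => x _; rewrite /Num.max oppr_lt0.
  by case: (ltrgtP (F x) 0) => [h|h|->]; rewrite ?sub0r ?opprK ?subr0 ?oppr0.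
move: g1 g2; set a1 := \sum_(_ <- _) _; set a2 := \sum_(_ <- _) _ => g1 g2 u2 u1.
by rewrite !ler_norml => /andP[n1 n2]; apply/andP; split; lra.
Qed.

Section Realification.
Variables (R : realType) (V : countType).
Implicit Types (f g : V -> R[i]) (s : seq V).

Definition rl f (p : V * bool) : R :=
  if p.2 then complex.Re (f p.1) else complex.Im (f p.1).

Definition cx (h : V * bool -> R) (x : V) : R[i] := (h (x, true) +i* h (x, false))%C.

Definition dbl s : seq (V * bool) := [seq (x, t) | x <- s, t <- [:: true; false]].

Lemma rl_cx h : rl (cx h) = h.
Proof. by apply/funext => -[x []]. Qed.

Lemma rl_inj f g : rl f = rl g -> f = g.
Proof.
move=> fg; apply/funext => x; have := congr1 (@^~ (x, true)) fg.
have := congr1 (@^~ (x, false)) fg; rewrite /rl /=.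
by case: (f x) => a b; case: (g x) => c d /= -> ->.
Qed.

Lemma rl_sub f g : rl (fun x => f x - g x) = (fun p => rl f p - rl g p).
Proof.
by apply/funext => -[x []]; rewrite /rl /=; case: (f x) => a b; case: (g x).
Qed.

Lemma big_dbl s (F : V * bool -> R) :
  \sum_(p <- dbl s) F p = \sum_(x <- s) (F (x, true) + F (x, false)).
Proof.
by rewrite /dbl big_allpairs /=; apply: eq_bigr => x _; rewrite !big_cons big_nil /= addr0.
Qed.

Lemma mem_dbl s p : (p \in dbl s) = (p.1 \in s).
Proof.
case: p => x t /=; apply/allpairsP/idP => [[[y t'] [ys _ [-> _]]] //|xs].
by exists (x, t); split=> //; case: t.
Qed.

Lemma uniq_dbl s : uniq s -> uniq (dbl s).
Proof. by move=> us; apply: allpairs_uniq => // -[x t] [y t']. Qed.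

Lemma subset_dbl (S : seq (V * bool)) s :
  {subset map fst S <= s} -> {subset S <= dbl s}.
Proof. by move=> sub p pS; rewrite mem_dbl; apply: sub; exact: map_f. Qed.

Definition wt (mu : V -> R) (p : V * bool) : R := mu p.1.

Lemma l2norm2_leP (mu : V -> R) f M : (forall x, 0 < mu x) ->
  (l2norm2 mu f <= M%:E)%E <-> l2_le (wt mu) (rl f) M.
Proof.
move=> mu0; rewrite /l2norm2 esum_leP.
have E s : \sum_(p <- dbl s) wt mu p * rl f p ^+ 2 = \sum_(x <- s) mu x * sqnorm (f x).
  by rewrite big_dbl; apply: eq_bigr => x _; rewrite /sqnorm mulrDr.
split=> h s us; last by rewrite -E; apply: h; exact: uniq_dbl.
apply: le_trans (h (undup (map fst s)) (undup_uniq _)); rewrite -E.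
apply: ler_sum_subset us _ _ => [|p]; last by rewrite mulr_ge0 ?sqr_ge0 // ltW // mu0.
by apply: subset_dbl => x; rewrite mem_undup.
Qed.

Lemma in_l2P (mu : V -> R) f : (forall x, 0 < mu x) ->
  in_l2 mu f <-> exists M, l2_le (wt mu) (rl f) M.
Proof.
move=> mu0; split=> [h|[M /l2norm2_leP h]]; last exact: le_lt_trans (h mu0) (ltry _).
exists (fine (l2norm2 mu f)); apply/l2norm2_leP => //; rewrite fineK // ge0_fin_numE //.
apply: esum_ge0 => x _; rewrite lee_fin mulr_ge0 ?(ltW (mu0 _)) //.
by rewrite /sqnorm addr_ge0 ?sqr_ge0.
Qed.

Lemma supported_l2 (mu : V -> R) (h : V * bool -> R) S : (forall x, 0 < mu x) ->
  supported h S -> exists M, l2_le (wt mu) h M.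
Proof.
move=> mu0 hS; exists (\sum_(p <- S) wt mu p * h p ^+ 2) => s us.
have ge0 p : 0 <= wt mu p * h p ^+ 2 by rewrite mulr_ge0 ?sqr_ge0 // ltW // mu0.
rewrite [leLHS](_ : _ = \sum_(p <- [seq p <- s | h p != 0]) wt mu p * h p ^+ 2).
  apply: ler_sum_subset => //; first exact: filter_uniq.
  by move=> p; rewrite mem_filter => /andP[/hS].
rewrite big_filter [RHS]big_mkcond; apply: eq_bigr => p _.
by case: eqP => //= ->; rewrite expr0n mulr0.
Qed.

Lemma finsupp_rl f : Defs.finsupp f <-> exists S, supported (rl f) S.
Proof.
split=> [fin|[S fS]].
  exists (dbl (fset_set [set x | f x != 0])) => -[x t] h; rewrite mem_dbl /= in_fset_set //.
  apply/mem_set => /=; apply: contraNneq h => fx; rewrite /rl /= fx.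
  by case: t.
apply: (@sub_finite_set _ _ [set` map fst S]); last exact: finite_seq.
move=> x /= fx; case: (eqVneq (rl f (x, true)) 0) => [h1|/fS h1]; last first.
  by have := map_f fst h1.
case: (eqVneq (rl f (x, false)) 0) => [h2|/fS h2]; last by have := map_f fst h2.
case/negP: fx; rewrite eq_complex; move: h1 h2; rewrite /rl /= => -> ->.
by rewrite eqxx.
Qed.

(** The density of the real part of the complex inner product, in real coordinates. *)
Definition pairing (mu : V -> R) (h k : V * bool -> R) (x : V) : R :=
  mu x * (h (x, true) * k (x, true) + h (x, false) * k (x, false)).

Lemma big_pairing mu h k s :
  \sum_(x <- s) pairing mu h k x = \sum_(p <- dbl s) wt mu p * h p * k p.
Proof. by rewrite big_dbl; apply: eq_bigr => x _; rewrite /pairing /wt /=; ring. Qed.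

Lemma pairing_summable mu h k Mh Mk : (forall x, 0 < mu x) ->
  l2_le (wt mu) h Mh -> l2_le (wt mu) k Mk ->
  forall s, uniq s -> \sum_(x <- s) `|pairing mu h k x| <= Mh + Mk.
Proof.
move=> mu0 hM kM s us.
apply: le_trans (lerD (hM _ (uniq_dbl us)) (kM _ (uniq_dbl us))).
rewrite !big_dbl -big_split /=; apply: ler_sum => x _.
rewrite /pairing normrM gtr0_norm // /wt /= -!mulrDr ler_wpM2l ?(ltW (mu0 x)) //.
set a := h _; set b := h _; set c := k _; set d := k _.
have A (u v : R) : u * v <= u ^+ 2 + v ^+ 2.
  by have := sqr_ge0 (u - v); have := sqr_ge0 u; have := sqr_ge0 v; lra.
have B (u v : R) : - (u * v) <= u ^+ 2 + v ^+ 2 by have := A (- u) v; rewrite sqrrN; lra.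
rewrite ler_norml; apply/andP; split.
  by have := B a c; have := B b d; lra.
by have := A a c; have := A b d; lra.
Qed.

Lemma rsum_supported mu h k S : (forall x, 0 < mu x) ->
  supported h S -> uniq S -> rsum (pairing mu h k) = \sum_(p <- S) wt mu p * h p * k p.
Proof.
move=> mu0 hS uS; pose c := \sum_(p <- S) wt mu p * h p * k p.
suff : `|rsum (pairing mu h k) - c| <= 0 by rewrite normr_le0 subr_eq0 => /eqP.
have sum_eq s : uniq s -> {subset map fst S <= s} -> \sum_(x <- s) pairing mu h k x = c.
  move=> us sub; rewrite big_pairing; apply: eq_sum_supp => //; first exact: uniq_dbl.
    move=> p; rewrite !mulf_eq0 !negb_or => /andP[/andP[_ /hS pS] _].
    exact: subset_dbl pS.
  by move=> p; rewrite !mulf_eq0 !negb_or => /andP[/andP[_ /hS]].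
(* [k] is arbitrary; cutting it to the support of [h] makes it square-summable without changing the
   pairing. *)
pose k' p := if h p == 0 then 0 else k p.
have E x : pairing mu h k x = pairing mu h k' x.
  by rewrite /pairing /k'; do 2!case: eqP => [->|_]; rewrite ?mul0r.
have [Mh hM] := supported_l2 mu0 hS.
have [Mk kM] : exists M, l2_le (wt mu) k' M.
  apply: (@supported_l2 mu _ S) => // p; rewrite /k'.
  by case: (eqVneq (h p) 0) => [_|/hS //]; rewrite eqxx.
apply: (@rsum_near _ _ _ (Mh + Mk) _ _ (map fst S)).
  move=> s us; under eq_bigr do rewrite E; exact: pairing_summable.
by move=> s us sub; rewrite sum_eq // subrr normr0.
Qed.

(** Cauchy-Schwarz in the form of Young's inequality; the free [lam] stands in for square roots. *)
Lemma pairing_close mu h k S (d M lam : R) : (forall x, 0 < mu x) ->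
  l2_le (wt mu) h d -> l2_le (wt mu) k M -> uniq S -> 0 < lam ->
  `|\sum_(p <- S) wt mu p * h p * k p| <= lam * d + M / lam.
Proof.
move=> mu0 hd kM uS lam0.
apply: le_trans (ler_norm_sum _ _ _) _.
apply: le_trans (_ : lam * (\sum_(p <- S) wt mu p * h p ^+ 2) +
    (\sum_(p <- S) wt mu p * k p ^+ 2) / lam <= _); last first.
  by apply: lerD; [rewrite ler_wpM2l ?(ltW lam0) ?hd | rewrite ler_wpM2r ?invr_ge0 ?(ltW lam0) ?kM].
rewrite mulr_sumr mulr_suml -big_split /=; apply: ler_sum => p _.
rewrite -mulrA normrM gtr0_norm; last exact: mu0.
have -> : lam * (wt mu p * h p ^+ 2) + wt mu p * k p ^+ 2 / lam =
  wt mu p * (lam * h p ^+ 2 + k p ^+ 2 / lam) by ring.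
rewrite ler_wpM2l ?(ltW (mu0 _)) //.
have e0 (x : R) : 0 <= lam^-1 * x ^+ 2 by rewrite mulr_ge0 ?sqr_ge0 // invr_ge0 ltW.
have h1 := e0 (lam * h p - k p); have h2 := e0 (lam * h p + k p).
have E (s : R) : s ^+ 2 = 1 -> lam^-1 * (lam * h p + s * k p) ^+ 2 =
    lam * h p ^+ 2 + k p ^+ 2 / lam + 2 * s * (h p * k p).
  move=> s1; transitivity (lam * h p ^+ 2 + s ^+ 2 * k p ^+ 2 / lam + 2 * s * (h p * k p)).
    by field; rewrite gt_eqF.
  by rewrite s1 mul1r.
have E1 := E 1 (expr1n _ _); have E2 := E (-1) (etrans (sqrrN 1) (expr1n _ _)).
rewrite mul1r in E1; rewrite mulN1r in E2; rewrite E1 in h2; rewrite E2 in h1.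
have q1 : 0 <= lam * h p ^+ 2 by rewrite mulr_ge0 ?sqr_ge0 // ltW.
have q2 : 0 <= k p ^+ 2 / lam by rewrite mulr_ge0 ?sqr_ge0 // invr_ge0 ltW.
by rewrite ler_norml; apply/andP; split; lra.
Qed.

End Realification.

(** * The magnetic Laplacian as a real kernel *)

Section MagneticKernel.
Variables (R : realType) (V : countType) (mu : V -> R) (b theta : V -> V -> R).
Variable W : V -> R.

Definition nbr (x : V) : seq V := enum_fset (fset_set [set y | 0 < b x y]).

(* [rot t s1 s2] is the entry of the plane rotation by the angle [t] in the
   basis (true = real part, false = imaginary part). *)
Definition rot (t : R) (s1 s2 : bool) : R :=
  if s1 == s2 then cos t else if s1 then - sin t else sin t.

(** The real matrix of the magnetic Laplacian: [rot] is multiplication by [expi], the diagonal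
    carries the weighted degree, and the other entries are minus a rotated edge weight. *)
Definition mag_kernel (p q : V * bool) : R :=
  (mu p.1)^-1 * ((p == q)%:R * (\sum_(y <- nbr p.1) b p.1 y) -
                 b p.1 q.1 * rot (theta p.1 q.1) p.2 q.2).

Definition mag_nbr (p : V * bool) : seq (V * bool) := dbl (p.1 :: nbr p.1).

Hypotheses (mu0 : forall x, 0 < mu x) (b0 : forall x y, 0 <= b x y).
Hypotheses (bsym : forall x y, b x y = b y x) (bxx : forall x, b x x = 0).
Hypotheses (lf : forall x, finite_set [set y | 0 < b x y]).
Hypotheses (thetaN : forall x y, theta x y = - theta y x).

Lemma mem_nbr x y : (y \in nbr x) = (0 < b x y).
Proof. by rewrite [LHS]in_fset_set //; apply/idP/idP => [/set_mem|/mem_set]. Qed.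

Lemma nbr_supp x y : b x y != 0 -> y \in nbr x.
Proof. by rewrite mem_nbr lt_def b0 andbT. Qed.

(** As [theta] is antisymmetric, exchanging the endpoints inverts the rotation, and the inverse of a
    rotation is its transpose. *)
Lemma mag_kernel_sym p q : wt mu p * mag_kernel p q = wt mu q * mag_kernel q p.
Proof.
rewrite /wt /mag_kernel !mulrA !divff ?gt_eqF // !mul1r (eq_sym q p) (bsym q.1 p.1).
congr (_ - _ * _).
  by case: eqP => [->|_]; rewrite ?mul0r.
rewrite (thetaN q.1) /rot (eq_sym q.2) cosN sinN opprK.
by case: (p.2); case: (q.2).
Qed.

Lemma uniq_mag_nbr p : uniq (mag_nbr p).
Proof.
by apply: uniq_dbl; rewrite /= fset_uniq andbT mem_nbr bxx ltxx.
Qed.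

Lemma mag_kernel_supp p q : mag_kernel p q != 0 -> q.1 = p.1 \/ 0 < b p.1 q.1.
Proof.
rewrite /mag_kernel; case: (eqVneq p q) => [->|_]; first by left.
case: (eqVneq (b p.1 q.1) 0) => [->|h _]; last by right; rewrite lt_def h b0.
by rewrite !mul0r subrr mulr0 eqxx.
Qed.

Lemma mag_kernel_nbr p q : mag_kernel p q != 0 -> q \in mag_nbr p.
Proof.
move=> /mag_kernel_supp h; rewrite mem_dbl inE mem_nbr.
by case: h => ->; rewrite ?eqxx ?orbT.
Qed.

(** The factor 3 counts the weighted degree once from the diagonal and twice from the two real
    components of each neighbour, the entries of a rotation being at most 1 in absolute value. *)
Lemma mag_kernel_row p :
  \sum_(q <- mag_nbr p) `|mag_kernel p q| <= (mu p.1)^-1 * (3 * \sum_(y <- nbr p.1) b p.1 y).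
Proof.
set D := \sum_(y <- nbr p.1) _.
have D0 : 0 <= D by apply: sumr_ge0.
have im0 : 0 <= (mu p.1)^-1 by rewrite invr_ge0 ltW.
have rot1 t s1 s2 : `|rot t s1 s2| <= 1.
  by rewrite /rot; case: ifP => _; [|case: ifP => _]; rewrite ?normrN ?cos_max ?sin_max.
apply: le_trans (_ : \sum_(q <- mag_nbr p) (mu p.1)^-1 * ((p == q)%:R * D + b p.1 q.1) <= _).
  apply: ler_sum => q _; rewrite /mag_kernel -/D normrM ger0_norm // ler_wpM2l //.
  apply: le_trans (ler_normB _ _) _; rewrite !normrM normr_nat (ger0_norm D0).
  by rewrite lerD2l (ger0_norm (b0 _ _)) ler_piMr.
rewrite -mulr_sumr ler_wpM2l // big_split /= -mulr_suml.
have pN : p \in mag_nbr p by rewrite mem_dbl mem_head.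
rewrite (bigD1_seq p pN (uniq_mag_nbr p)) /=.
rewrite eqxx big1 => [|q /negPf qp]; last by rewrite eq_sym qp.
by rewrite big_dbl big_cons bxx !add0r big_split /= -/D addr0 mul1r; lra.
Qed.

Lemma ReM_real (a : R) (z : R[i]) : complex.Re ((a%:C)%C * z) = a * complex.Re z.
Proof. by case: z => x y /=; rewrite mul0r subr0. Qed.

Lemma ImM_real (a : R) (z : R[i]) : complex.Im ((a%:C)%C * z) = a * complex.Im z.
Proof. by case: z => x y /=; rewrite mul0r addr0. Qed.

Lemma rl_mag_lap u : rl (mag_lap mu b theta u) = kop mag_kernel mag_nbr (rl u).
Proof.
apply/funext => -[x t].
pose T y : R[i] := ((b x y)%:C)%C * (u x - expi (theta x y) * u y).
have -> : rl (mag_lap mu b theta u) (x, t) =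
    (mu x)^-1 * \sum_(y <- nbr x) rl T (y, t).
  rewrite /rl /mag_lap /= ReM_real ImM_real.
  rewrite (@fsbigE _ _ _ _ _ (nbr x)) ?fset_uniq //; last first.
    move=> y _ yn; have -> : b x y = 0.
      by apply/eqP; apply: contraNT yn; exact: nbr_supp.
    by rewrite mul0r.
  rewrite (eq_bigl xpredT) => [|y]; last by rewrite in_setT.
  case: t; congr (_ * _).
    by rewrite (@big_morph _ _ (@complex.Re R) 0 +%R 0 +%R) // => -[? ?] [? ?].
  by rewrite (@big_morph _ _ (@complex.Im R) 0 +%R 0 +%R) // => -[? ?] [? ?].
rewrite /kop /mag_nbr big_dbl big_cons /= mulr_sumr.
(* The weighted degree on the diagonal is spread over the neighbours, so that both sides can be
   compared term by term. *)
have -> : mag_kernel (x, t) (x, true) * rl u (x, true) +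
    mag_kernel (x, t) (x, false) * rl u (x, false) =
    \sum_(y <- nbr x) (mu x)^-1 * (b x y * rl u (x, t)).
  rewrite /mag_kernel /= bxx !mul0r !subr0 -!mulr_sumr -mulr_suml.
  by case: t; rewrite !xpair_eqE !eqxx /=; ring.
rewrite -big_split /=; apply: eq_big_seq => y; rewrite mem_nbr => yn.
have yx : (x == y) = false.
  by apply/negP => /eqP e; move: yn; rewrite e bxx ltxx.
rewrite /mag_kernel !xpair_eqE yx /= !mul0r !sub0r /rl /T /= ReM_real ImM_real.
rewrite /expi /rot; case: t => /=; case: (u x) => a1 a2; case: (u y) => c1 c2 /=; ring.
Qed.

Lemma rl_Hop u : rl (Hop mu b theta W u) = hop mag_kernel mag_nbr (fun p => W p.1) (rl u).
Proof.
apply/funext => p; rewrite /hop -!rl_mag_lap /rl /Hop.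
case: (p.2); move: (mag_lap _ _ _ _ _) (u p.1) => -[a1 a2] [c1 c2] /=; ring.
Qed.

(** * Closure, symmetry and adjoint *)

Let K := mag_kernel.
Let N := mag_nbr.
Let H := hop K N (fun p => W p.1).
Let m := wt mu.
Let m0 p : 0 < m p. Proof. exact: mu0. Qed.

Hypothesis vanish : forall (a c : V * bool -> R) (Ma Mc : R),
  l2_le m a Ma -> l2_le m c Mc ->
  (forall x, H a x = c x) -> (forall x, H c x = - a x) -> forall x, a x = 0.

Let approx v Mv Mw e : l2_le m v Mv -> l2_le m (H v) Mw -> 0 < e ->
  exists u s, [/\ supported u s,
    l2_le m (fun x => v x - u x) e & l2_le m (fun x => H v x - H u x) e].
Proof.
move=> vM wM e0.
exact: (@graph_approx R _ m K N _ m0 mag_kernel_sym uniq_mag_nbr mag_kernel_nbr vanish v Mv Mw vM wM e e0).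
Qed.

(** Symmetry on the maximal domain: [u] is replaced by a finitely supported [phi] close in the graph
    norm, for which [hop_adj] is exact. *)
Lemma hop_rsum_sym u v Mu MHu Mv MHv :
  l2_le m u Mu -> l2_le m (H u) MHu -> l2_le m v Mv -> l2_le m (H v) MHv ->
  rsum (pairing mu (H u) v) = rsum (pairing mu u (H v)).
Proof.
move=> uM HuM vM HvM.
apply/eqP; rewrite -subr_eq0 -normr_le0; apply/ler_addgt0Pr => e e0; rewrite add0r.
have Mv0 : 0 <= Mv by have := vM [::] isT; rewrite big_nil.
have MHv0 : 0 <= MHv by have := HvM [::] isT; rewrite big_nil.
(* First [lam] makes the terms [M / lam] at most [e / 4], then [d] is set so that [lam * d = e / 4];
   each of the two replacements costs at most [e / 2]. *)
pose lam := (Mv + MHv) * 4 / e + 1.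
have lam0 : 0 < lam by rewrite ltr_wpDl // divr_ge0 ?(ltW e0) // mulr_ge0 // addr_ge0.
have lamM : (Mv + MHv) / lam <= e / 4.
  rewrite ler_pdivrMr // /lam mulrDr mulr1.
  have -> : e / 4 * ((Mv + MHv) * 4 / e) = Mv + MHv by field; rewrite gt_eqF.
  by rewrite lerDl divr_ge0 // ltW.
have MvL : Mv / lam <= e / 4.
  by apply: le_trans lamM; rewrite ler_wpM2r ?invr_ge0 ?(ltW lam0) // lerDl.
have MHvL : MHv / lam <= e / 4.
  by apply: le_trans lamM; rewrite ler_wpM2r ?invr_ge0 ?(ltW lam0) // lerDr.
pose d := e / (4 * lam).
have d0 : 0 < d by rewrite divr_gt0 // mulr_gt0.
have lamd : lam * d = e / 4 by rewrite /d; field; rewrite gt_eqF.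
have [phi [s0 [phis ud Hud]]] := approx uM HuM d0.
pose S0 := s0 ++ flatten (map N s0) ++ flatten (map N (flatten (map N s0))).
have phiS : supported phi S0 by move=> p /phis h; rewrite mem_cat h.
have HphiS : supported (H phi) S0.
  move=> p /(supported_hop m0 mag_kernel_sym mag_kernel_nbr phis); rewrite !mem_cat.
  by case/orP => ->; rewrite ?orbT.
pose A0 := undup (map fst S0).
pose c := \sum_(p <- dbl A0) m p * H phi p * v p.
have subA0 : {subset S0 <= dbl A0} by apply: subset_dbl => x; rewrite mem_undup.
have uA0 : uniq (dbl A0) by apply: uniq_dbl; exact: undup_uniq.
have c_eq : c = \sum_(p <- dbl A0) m p * phi p * H v p.
  exact: (hop_adj _ m0 mag_kernel_sym uniq_mag_nbr mag_kernel_nbr _ phis).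
have enlarge (h k : V * bool -> R) s : supported h S0 -> uniq s -> {subset A0 <= s} ->
    \sum_(p <- dbl A0) m p * h p * k p = \sum_(p <- dbl s) m p * h p * k p.
  move=> hS us sub; apply: eq_sum_supp => //; first exact: uniq_dbl.
    by move=> p; rewrite !mulf_eq0 !negb_or => /andP[/andP[_ /hS /subA0]].
  move=> p; rewrite !mulf_eq0 !negb_or => /andP[/andP[_ /hS /subA0]].
  by rewrite !mem_dbl => /sub.
have close (h h' k : V * bool -> R) Mh Mk : l2_le m h Mh -> l2_le m k Mk ->
    supported h' S0 -> l2_le m (fun p => h p - h' p) d -> Mk / lam <= e / 4 ->
    `|rsum (pairing mu h k) - \sum_(p <- dbl A0) m p * h' p * k p| <= e / 2.
  move=> hM kM h'S hd MkL; apply: (rsum_near (s0 := A0)).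
    exact: (pairing_summable mu0 hM kM).
  move=> s us sub; rewrite (enlarge _ _ s) // big_pairing -sumrB.
  under eq_bigr do rewrite -mulrBl -mulrBr.
  apply: le_trans (pairing_close mu0 hd kM (uniq_dbl us) lam0) _.
  by rewrite lamd; lra.
have h1 := close _ _ _ _ _ HuM vM HphiS Hud MvL.
have h2 := close _ _ _ _ _ uM HvM phiS ud MHvL.
rewrite -c_eq in h2; rewrite -/c in h1.
apply: le_trans (_ : `|rsum (pairing mu (H u) v) - c| + `|c - rsum (pairing mu u (H v))| <= _).
  by apply: le_trans (ler_normD _ _); rewrite addrA subrK.
by rewrite (distrC c); lra.
Qed.

Let G := H_on_Cc mu b theta W.

Lemma l2_cvg (f : nat -> V -> R[i]) (g : V -> R[i]) :
  (forall e : R, 0 < e -> exists n0 : nat, forall n, (n0 <= n)%N ->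
    (l2norm2 mu (fun x => (f n x - g x)%R) < e%:E)%E) ->
  forall p, rl (f n) p @[n --> \oo] --> rl g p.
Proof.
move=> fg p; apply/cvgrPdist_le => e e0.
have e'0 : 0 < m p * e ^+ 2 by rewrite mulr_gt0 ?exprn_gt0.
have [n0 hn0] := fg _ e'0; exists n0 => // n /= /hn0 /ltW /(l2norm2_leP _ _ mu0).
rewrite rl_sub => /(_ [:: p] isT); rewrite big_cons big_nil addr0 ler_pM2l //.
rewrite -[X in X <= _]real_normK ?num_real // ler_pXn2r ?nnegrE ?(ltW e0) //.
by rewrite distrC.
Qed.

(** Convergence in the weighted space is pointwise convergence in particular, and [hop] respects
    pointwise limits. *)
Lemma closure_hop v w : closure_op mu G v w -> rl w = H (rl v).
Proof.
move=> [_ _ [un [wn [Gn near]]]]; apply/funext => p.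
have cw : rl (wn n) p @[n --> \oo] --> rl w p.
  by apply: l2_cvg => e /near[n0 h]; exists n0 => n /h[].
have cv : H (rl (un n)) p @[n --> \oo] --> H (rl v) p.
  by apply: hop_cvg => q; apply: l2_cvg => e /near[n0 h]; exists n0 => n /h[].
have E : (fun n => rl (wn n) p) = (fun n => H (rl (un n)) p).
  by apply/funext => n; have [_ ->] := Gn n; rewrite rl_Hop.
by move: cw; rewrite [X in nbhs (X @ _)]E => cw; exact: cvg_unique cw cv.
Qed.

(** Converse of [closure_hop]: approximation in the graph norm shows that the closure is the maximal
    operator. *)
Lemma hop_closure v w : in_l2 mu v -> in_l2 mu w -> rl w = H (rl v) ->
  closure_op mu G v w.
Proof.
move=> vl2 wl2 wH; split=> //.
move: vl2 wl2 => /(in_l2P _ mu0) [Mv vM] /(in_l2P _ mu0) [Mw wM].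
have HvM : l2_le m (H (rl v)) Mw by rewrite -wH.
have ex n : exists u : V -> R[i], [/\ Defs.finsupp u,
    l2_le m (fun p => rl v p - rl u p) n.+1%:R^-1 &
    l2_le m (fun p => H (rl v) p - H (rl u) p) n.+1%:R^-1].
  have n0 : 0 < n.+1%:R^-1 :> R by rewrite invr_gt0.
  have [u [s [us h1 h2]]] := approx vM HvM n0.
  by exists (cx u); rewrite rl_cx; split=> //; apply/finsupp_rl; exists s; rewrite rl_cx.
have [u uP] := choice ex.
exists u, (fun n => Hop mu b theta W (u n)); split; first by move=> n; have [] := uP n.
move=> e e0; exists (Num.truncn e^-1) => n hn.
have ne : n.+1%:R^-1 < e.
  rewrite invf_plt ?posrE //; apply: lt_le_trans (truncnS_gt _) _.
  by rewrite ler_nat ltnS.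
have flip (h k : V * bool -> R) : l2_le m (fun p => h p - k p) n.+1%:R^-1 ->
    l2_le m (fun p => k p - h p) n.+1%:R^-1.
  by move=> hk s us; under eq_bigr do rewrite -opprB sqrrN; exact: hk.
have [_ /flip h1 /flip h2] := uP n.
split; apply: le_lt_trans (_ : (_ <= n.+1%:R^-1%:E)%E) _; rewrite ?lte_fin //.
  by apply/l2norm2_leP; rewrite ?rl_sub.
by apply/l2norm2_leP; rewrite ?rl_sub // rl_Hop wH.
Qed.

Lemma hop_closure_finsupp u : Defs.finsupp u -> closure_op mu G u (Hop mu b theta W u).
Proof.
move=> /finsupp_rl [s us]; apply: hop_closure; last exact: rl_Hop.
  by apply/in_l2P => //; exact: supported_l2 us.
apply/in_l2P => //; rewrite rl_Hop.
exact: supported_l2 (supported_hop m0 mag_kernel_sym mag_kernel_nbr us).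
Qed.

(** The imaginary part of [(f, g)] is the real part of [(f, i g)]; with [Hop_i], identities between
    real pairings then give the complex ones. *)
Lemma l2ip_rsum f g : l2ip mu f g =
  (rsum (pairing mu (rl f) (rl g)) +i* rsum (pairing mu (rl f) (rl (fun x => 'i * g x))))%C.
Proof.
congr (_ +i* _)%C; congr rsum; apply/funext => x; rewrite /pairing /rl /=.
  by case: (f x) => a1 a2; case: (g x) => c1 c2 /=; ring.
by case: (f x) => a1 a2; case: (g x) => c1 c2 /=; ring.
Qed.

Lemma Hop_i (u : V -> R[i]) : Hop mu b theta W (fun x => 'i * u x) =
  (fun x => 'i * Hop mu b theta W u x).
Proof.
have mag_i (f : V -> R[i]) : mag_lap mu b theta (fun x => 'i * f x) =
    (fun x => 'i * mag_lap mu b theta f x).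
  apply/funext => x; rewrite /mag_lap mulrCA; congr (_ * _).
  rewrite !(@fsbigE _ _ _ _ _ (nbr x)) ?fset_uniq //.
  - by rewrite mulr_sumr; apply: eq_bigr => y _; ring.
  - by move=> y _ yn; have /eqP -> : b x y == 0 by [apply: contraNT yn; exact: nbr_supp]; rewrite mul0r.
  - by move=> y _ yn; have /eqP -> : b x y == 0 by [apply: contraNT yn; exact: nbr_supp]; rewrite mul0r.
by apply/funext => x; rewrite /Hop !mag_i; ring.
Qed.

Lemma in_l2_i (u : V -> R[i]) : in_l2 mu u -> in_l2 mu (fun x => 'i * u x).
Proof.
rewrite /in_l2 /l2norm2; congr (_ < _)%E; apply: eq_esum => x _.
by rewrite /sqnorm; case: (u x) => a c /=; congr (_%:E); ring.
Qed.

(** One inclusion is the symmetry of the maximal operator. For the other, the adjoint relation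
    tested on point masses forces [w = H v], so [v] lies in the maximal domain, which is that of the
    closure. *)
Lemma ess_self_adjoint_of_vanish : ess_self_adjoint mu G.
Proof.
move=> v w; split=> [vw|[vl2 wl2 adj]].
  have [vl2 wl2 _] := vw; have wH := closure_hop vw.
  split=> // u z uz; have [ul2 zl2 _] := uz; have zH := closure_hop uz.
  have sym v' w' : in_l2 mu v' -> in_l2 mu w' -> rl w' = H (rl v') ->
      rsum (pairing mu (rl z) (rl v')) = rsum (pairing mu (rl u) (rl w')).
    move=> /(in_l2P _ mu0) [Mv vM] /(in_l2P _ mu0) [Mw wM] w'H.
    have [Mu uM] := (in_l2P _ mu0).1 ul2; have [Mz zM] := (in_l2P _ mu0).1 zl2.
    rewrite w'H in wM *; rewrite zH in zM *; exact: hop_rsum_sym uM zM vM wM.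
  rewrite !l2ip_rsum; congr (_ +i* _)%C; first exact: sym.
  apply: sym; [exact: in_l2_i | exact: in_l2_i |].
  rewrite /H -rl_Hop Hop_i (_ : w = Hop mu b theta W v) //.
  by apply: rl_inj; rewrite rl_Hop.
apply: hop_closure => //; apply/funext => p.
pose d (q : V * bool) : R := (q == p)%:R.
have ds : supported d [:: p] by move=> q; rewrite /d inE; case: (q == p); rewrite ?eqxx.
have dfin : Defs.finsupp (cx d) by apply/finsupp_rl; exists [:: p]; rewrite rl_cx.
(* The real part is enough: [p] ranges over both components, and a unit mass at [(x, false)] is [i]
   times the indicator of [x]. *)
have := adj _ _ (hop_closure_finsupp dfin); rewrite !l2ip_rsum => -[+ _].
rewrite rl_Hop rl_cx.
pose S := undup ([:: p] ++ flatten (map N [:: p]) ++ flatten (map N (flatten (map N [:: p])))).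
have uS : uniq S by exact: undup_uniq.
have pS : p \in S by rewrite mem_undup inE eqxx.
have dS : supported d S by move=> q /ds; rewrite inE => /eqP ->.
have HdS : supported (H d) S.
  move=> q /(supported_hop m0 mag_kernel_sym mag_kernel_nbr ds); rewrite mem_undup !mem_cat.
  by case/orP => -> //; rewrite !orbT.
rewrite (rsum_supported _ mu0 HdS uS) (rsum_supported _ mu0 dS uS).
rewrite (@hop_adj _ _ _ _ _ _ m0 mag_kernel_sym uniq_mag_nbr mag_kernel_nbr _ _ [:: p]) //; last first.
  by move=> q qs; rewrite mem_undup.
have pick (f : V * bool -> R) : \sum_(q <- S) m q * d q * f q = m p * f p.
  rewrite (bigD1_seq p) //= /d eqxx mulr1 big1 ?addr0 // => q /negPf ->.
  by rewrite mulr0 mul0r.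
by rewrite !pick => /(mulfI (lt0r_neq0 (m0 p))) /esym.
Qed.

End MagneticKernel.

(** * Balls of the combinatorial distance *)

Section GraphGeometry.
Variables (R : realType) (V : countType) (b : V -> V -> R) (x0 : V).
Hypotheses (b0 : forall x y, 0 <= b x y).
Hypotheses (lf : forall x, finite_set [set y | 0 < b x y]).
Hypothesis conn : graph_connected b.

Let in_nbr x y : (y \in nbr b x) = (0 < b x y).
Proof. exact: mem_nbr. Qed.

(** Connectedness makes the set of walk lengths nonempty, so [gdist] is a true minimum rather than
    the default 0. *)
Lemma gdistP y : walk b x0 y (gdist b x0 y) /\
  forall n, walk b x0 y n -> (gdist b x0 y <= n)%N.
Proof.
apply: (xgetPex 0%N (P := [set n | walk b x0 y n /\ forall k, walk b x0 y k -> (n <= k)%N])).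
have [n wn] := conn x0 y.
have ex : exists n, `[< walk b x0 y n >] by exists n; apply/asboolP.
case: (ex_minnP ex) => k /asboolP wk kmin.
by exists k; split=> // i wi; apply: kmin; apply/asboolP.
Qed.

Lemma walk_rcons x y z n : walk b x y n -> 0 < b y z -> walk b x z n.+1.
Proof.
move=> [p [p0 pn pb]] yz; exists (fun i => if (i <= n)%N then p i else z); split.
- by rewrite leq0n.
- by rewrite ltnn.
- move=> i; rewrite ltnS => le_in; rewrite le_in.
  by case: ltnP => [/pb //|ni]; rewrite (_ : i = n) ?pn //; apply/eqP; rewrite eqn_leq le_in.
Qed.

Lemma walk_last x z n : walk b x z n.+1 -> exists2 y, walk b x y n & 0 < b y z.
Proof.
move=> [p [p0 pn pb]]; exists (p n); last by rewrite -pn; exact: pb.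
by exists p; split=> // i lt; apply: pb; rewrite ltnW.
Qed.

Lemma gdist_edge y z : 0 < b y z -> (gdist b x0 z <= (gdist b x0 y).+1)%N.
Proof.
by move=> yz; apply: (gdistP z).2; apply: walk_rcons yz; exact: (gdistP y).1.
Qed.

(** By local finiteness: walks of length at most [n + 1] end at [x0] or at a neighbour of an end
    point of a walk of length at most [n]. *)
Lemma ball_finite n : exists s : seq V, forall x, (gdist b x0 x <= n)%N -> x \in s.
Proof.
suff [s sP] : exists s : seq V, forall k x, (k <= n)%N -> walk b x0 x k -> x \in s.
  by exists s => x /sP; apply; exact: (gdistP x).1.
elim: n => [|n [s sP]].
  exists [:: x0] => k x; rewrite leqn0 => /eqP -> [p [p0 pn _]].
  by rewrite inE -pn p0.
exists (x0 :: flatten (map (nbr b) s)) => -[|k] x.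
  by move=> _ [p [p0 pn _]]; rewrite inE -pn p0 eqxx.
rewrite ltnS => kn /walk_last [y wy yx]; rewrite inE; apply/orP; right.
apply/flattenP; exists (nbr b y); last by rewrite in_nbr.
by apply: map_f; exact: sP wy.
Qed.

(** At most [d_n] terms, each at most [p_n]. Finiteness of the ball bounds the two sets whose
    suprema define these numbers; without it [sup] would say nothing. *)
Lemma degree_le_dp n x : (gdist b x0 x <= n)%N ->
  \sum_(y <- nbr b x) b x y <= d_seq b x0 n * p_seq b x0 n.
Proof.
move=> xn; have [s sP] := ball_finite n.
have hd : (deg b x)%:R <= d_seq b x0 n.
  apply: ub_le_sup; last by exists x.
  exists (\sum_(y <- s) (deg b y)%:R) => _ [y /= yn <-].
  apply: le_trans (_ : \sum_(z <- [:: y]) (deg b z)%:R <= _).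
    by rewrite big_cons big_nil addr0.
  by apply: ler_sum_subset => // z; rewrite inE => /eqP ->; exact: sP.
have hp y : b x y <= p_seq b x0 n.
  apply: ub_le_sup; last by exists (x, y).
  exists (\sum_(z <- s) \sum_(w <- nbr b z) b z w) => _ [[z w] /= zn <-].
  apply: le_trans (_ : \sum_(w <- nbr b z) b z w <= _).
    case: (eqVneq (b z w) 0) => [->|zw]; first exact: sumr_ge0.
    apply: le_trans (_ : \sum_(u <- [:: w]) b z u <= _).
      by rewrite big_cons big_nil addr0.
    by apply: ler_sum_subset => // u; rewrite inE => /eqP ->; rewrite in_nbr lt_def zw b0.
  apply: le_trans (_ : \sum_(z' <- [:: z]) \sum_(w <- nbr b z') b z' w <= _).
    by rewrite big_cons big_nil addr0.
  apply: ler_sum_subset => // [u|u]; first by rewrite inE => /eqP ->; exact: sP.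
  exact: sumr_ge0.
apply: le_trans (_ : \sum_(y <- nbr b x) p_seq b x0 n <= _).
  by apply: ler_sum => y _; exact: hp.
rewrite big_const_seq count_predT iter_addr_0 -mulr_natl ler_wpM2r //.
exact: le_trans (b0 x x) (hp x).
Qed.

End GraphGeometry.

(** * The growth hypotheses and the conclusion *)

Theorem theorem2p1 (R : realType) (V : countType) (mu : V -> R)
  (b : V -> V -> R) (theta : V -> V -> R) (q : R -> R) (alpha : R)
  (W : V -> R) (x0 : V) (mu0 : R) :
  infinite_set [set: V] ->
  (forall x, 0 < mu x) ->
  (forall x y, 0 <= b x y) ->
  (forall x y, b x y = b y x) ->
  (forall x, b x x = 0) ->
  (forall x, finite_set [set y | 0 < b x y]) ->
  graph_connected b ->
  0 < mu0 -> (forall x, mu0 <= mu x) ->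
  (forall x y, - pi <= theta x y <= pi) ->
  (forall x y, theta x y = - theta y x) ->
  (forall s, 0 <= s -> 0 < q s) ->
  (forall s t, 0 <= s -> s <= t -> q s <= q t) ->
  0 <= alpha <= 1 ->
  (exists C M : R, forall s, M <= s -> `|q s| <= C * s `^ alpha) ->
  (forall x, - q (gdist b x0 x)%:R <= W x) ->
  (0 < alpha -> exists M : R, forall n : nat, (0 < n)%N ->
      `|n%:R `^ (alpha - 1) * d_seq b x0 n * p_seq b x0 n| <= M) ->
  (alpha = 0 -> exists (K : R) (N : nat), [/\ 0 < K, K < mu0 / 2, (0 < N)%N &
      forall n : nat, (N <= n)%N -> d_seq b x0 n * p_seq b x0 n / n%:R <= K]) ->
  ess_self_adjoint mu (H_on_Cc mu b theta W).
Proof.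
move=> _ mu_gt0 b0 bsym bxx lf conn mu0_gt0 mu_ge _ thetaN q_gt0 q_nd /andP[al0 al1].
move=> [C [M qC]] WP hpos hzero.
(* Both cases of the growth hypothesis take the common form [d_k p_k k^alpha <= P k] for large
   [k]. *)
have [P [n1 [P0 dpP]]] : exists (P : R) (n1 : nat), 0 <= P /\
    forall k, (n1 <= k)%N -> (0 < k)%N ->
      d_seq b x0 k * p_seq b x0 k * k%:R `^ alpha <= P * k%:R.
  case: (eqVneq alpha 0) => [a0|a_neq0].
    have [K [N [K0 _ _ hK]]] := hzero a0; exists K, N; split; first exact: ltW.
    by move=> k Nk k0; rewrite a0 powRr0 mulr1 -ler_pdivrMr ?ltr0n // hK.
  have [M' hM'] : exists M : R, forall n : nat, (0 < n)%N ->
      `|n%:R `^ (alpha - 1) * d_seq b x0 n * p_seq b x0 n| <= M.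
    by apply: hpos; rewrite lt_def a_neq0.
  exists `|M'|, 0%N; split=> // k _ k0; have kR : 0 < k%:R :> R by rewrite ltr0n.
  have -> : d_seq b x0 k * p_seq b x0 k * k%:R `^ alpha =
      k%:R `^ (alpha - 1) * d_seq b x0 k * p_seq b x0 k * k%:R.
    rewrite (_ : k%:R `^ alpha = k%:R `^ (alpha - 1) * k%:R); first by ring.
    have := @powRD R k%:R (alpha - 1) 1; rewrite (gt_eqF kR) implybT subrK powRr1 ?(ltW kR) //; exact.
  rewrite ler_pM2r //; apply: le_trans (ler_norm _) _.
  by apply: le_trans (hM' k k0) _; exact: ler_norm.
(* The 12 is the row-sum factor 3 times the 4 of [k <= 4 n]; the 4 before [C] comes from
   [k^alpha <= 4 t]; the 1 makes [c] positive. *)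
pose c := 12 * P / mu0 + 4 * `|C| + 1.
have c1 : 0 <= 12 * P / mu0 by rewrite divr_ge0 ?(ltW mu0_gt0) // mulr_ge0.
have c_gt0 : 0 < c by rewrite ltr_wpDl // addr_ge0 // mulr_ge0.
(* Large enough for [k] to pass both [n1] and [M], and for [n >= 1]. *)
pose n0 := (n1 + Num.truncn `|M| + 1)%N.
apply: ess_self_adjoint_of_vanish => // a a' Ma Ma' aM a'M Ha Ha'.
apply: (@deficiency_vanish R _ (wt mu) (mag_kernel mu b theta) (mag_nbr b) _
  (fun p => gdist b x0 p.1) c n0 a a' Ma Ma') => //.
- by move=> p; exact: mu_gt0.
- exact: mag_kernel_sym.
- by move=> p p' /(mag_kernel_supp b0) [->|/gdist_edge]; [exact: leqnSn | exact].
- exact: uniq_mag_nbr.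
- exact: mag_kernel_nbr.
- move=> n; have [s sP] := ball_finite x0 lf conn n.
  by exists (dbl s) => p /sP; rewrite mem_dbl.
move=> n n0n; pose t : R := n%:R `^ alpha; pose k := n.*2.+2.
have n_ge1 : (1 <= n)%N by apply: leq_trans n0n; rewrite /n0 addn1.
have nR1 : 1 <= n%:R :> R by rewrite ler1n.
have t1 : 1 <= t by rewrite -(powRr0 n%:R) /t ler_powR.
have t_gt0 : 0 < t by exact: lt_le_trans t1.
exists t => // p pk.
have n0k : (n0 <= k)%N by rewrite (leq_trans n0n) // /k -addnn -addn2 -addnA leq_addr.
have k4 : k%:R <= 4 * n%:R :> R by rewrite -natrM ler_nat /k; lia.
have nk : n%:R <= k%:R :> R by rewrite ler_nat /k; lia.
have k_gt0 : 0 < k%:R :> R by rewrite ltr0n.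
have tk : t <= k%:R `^ alpha by rewrite ge0_ler_powR ?nnegrE.
(* Here [alpha <= 1] is used: [4^alpha <= 4]. *)
have k4t : k%:R `^ alpha <= 4 * t.
  apply: le_trans (_ : (4 * n%:R) `^ alpha <= _).
    by rewrite ge0_ler_powR ?nnegrE ?mulr_ge0.
  rewrite powRM // ler_wpM2r ?(ltW t_gt0) //.
  by rewrite -[leRHS]powRr1 // ler_powR // ler1n.
have D_le := degree_le_dp b0 lf conn pk; rewrite -/k in D_le.
have dp := dpP k; split.
  apply: le_trans (mag_kernel_row _ _ _ _ _ _) _ => //.
  set D := \sum_(y <- _) _ in D_le *.
  have D0 : 0 <= D by apply: sumr_ge0.
  have Dt : D * t <= P * (4 * n%:R).
    apply: le_trans (_ : D * k%:R `^ alpha <= _); first by rewrite ler_wpM2l.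
    apply: le_trans (_ : d_seq b x0 k * p_seq b x0 k * k%:R `^ alpha <= _).
      by rewrite ler_wpM2r ?powR_ge0.
    apply: le_trans (dp _ _) _ => //; last by rewrite ler_wpM2l.
    by apply: leq_trans n0k; rewrite /n0 -addnA leq_addr.
  rewrite ler_pdivlMr //.
  apply: le_trans (_ : mu0^-1 * (3 * D) * t <= _).
    by rewrite ler_wpM2r ?(ltW t_gt0) // ler_wpM2r ?mulr_ge0 // lef_pV2 ?posrE.
  apply: le_trans (_ : 12 * P / mu0 * n%:R <= _).
    have := ler_wpM2l (ltW (divr_gt0 (ltr0n R 3) mu0_gt0)) Dt.
    by rewrite (_ : 3 / mu0 * (D * t) = mu0^-1 * (3 * D) * t) 1?(_ : 3 / mu0 * (P * (4 * n%:R)) =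
      12 * P / mu0 * n%:R) //; ring.
  by rewrite ler_wpM2r // /c -addrA lerDl addr_ge0 // mulr_ge0.
apply: le_trans (WP p.1); rewrite lerN2.
(* Monotonicity moves from [r(x)], which may be small, to the radius [k], where the growth bound on
   [q] is in force. *)
apply: le_trans (_ : q k%:R <= _); first by apply: q_nd; rewrite // ler_nat.
have Mk : M <= k%:R.
  apply: le_trans (ler_norm M) _; apply: le_trans (ltW (truncnS_gt _)) _.
  by rewrite ler_nat; apply: leq_trans n0k; rewrite /n0 addn1 ltnS leq_addl.
apply: le_trans (ler_norm _) _; apply: le_trans (qC _ Mk) _.
apply: le_trans (_ : `|C| * (4 * t) <= _).
  by apply: le_trans (ler_wpM2r (powR_ge0 _ _) (ler_norm C)) _; rewrite ler_wpM2l.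
rewrite mulrA ler_wpM2r ?(ltW t_gt0) // /c (mulrC `|C|).
by move: c1; lra.
Qed.
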